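(* Let $d\ge 1$ and let $r\ge 1$ be an integer. If $M$ and $N$ are two upset-decomposable persistence modules over $\mathbb{R}^d$ of pointwise dimension at most $r$ (that is, $\dim M_p\le r$ and $\dim N_p\le r$ for all $p\in\mathbb{R}^d$), then \[ d_P(M,N)\;\le\; d_B(M,N)\;\le\;(2r-1)\,d_P(M,N). \]
   Context: Fix a field $k$. $\mathbb{R}^d$ carries the product order; for $\varepsilon\in\mathbb{R}$ and $p\in\mathbb{R}^d$ write $p+\varepsilon:=p+(\varepsilon,\dots,\varepsilon)$. A (persistence) module is a functor $M$ from the poset $\mathbb{R}^d$ to $k$-vector spaces, with spaces $M_p$ and maps $M_{p\to q}$ for $p\le q$; morphisms are natural transformations; direct sums, submodules, images, preimages and quotients are pointwise. $M$ is pointwise finite-dimensional (pfd) if every $M_p$ is finite-dimensional. The shift $M(\varepsilon)$ is $M(\varepsilon)_p=M_{p+\varepsilon}$, $M(\varepsilon)_{p\to q}=M_{p+\varepsilon\to q+\varepsilon}$ (and $f(\varepsilon)$ denotes the shifted morphism); for $\varepsilon\le\delta$, $M_{\varepsilon\to\delta}:M(\varepsilon)\to M(\delta)$ is given at $p$ by $M_{p+\varepsilon\to p+\delta}$. Upset modules: an upset is $U\subseteq\mathbb{R}^d$ such that $p\in U$, $q\ge p$ imply $q\in U$. The associated upset module has $M_p=k$ for $p\in U$, $M_p=0$ otherwise, with $M_{p\to q}=\mathrm{Id}_k$ for $p\in U$, $p\le q$. A module is upset-decomposable if it is isomorphic to a direct sum of upset modules. Barcode: a pfd module $M$ is isomorphic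 to a direct sum $\bigoplus_{i\in I}M_i$ of nonzero indecomposables, unique up to isomorphism and reindexing; the barcode $B(M)$ is the multiset $\{M_i\}_{i\in I}$ of isomorphism classes. Interleavings: $M\sim_\varepsilon N$ ($\varepsilon$-interleaved) means there are morphisms $\varphi:M\to N(\varepsilon)$, $\psi:N\to M(\varepsilon)$ with $\psi(\varepsilon)\circ\varphi=M_{0\to2\varepsilon}$ and $\varphi(\varepsilon)\circ\psi=N_{0\to2\varepsilon}$. Bottleneck distance: an $\varepsilon$-matching between pfd modules $M,N$ is a bijection $\sigma:\bar B(M)\to\bar B(N)$ between sub-multisets $\bar B(M)\subseteq B(M)$, $\bar B(N)\subseteq B(N)$ such that $Q\sim_\varepsilon\sigma(Q)$ for all $Q\in\bar B(M)$ and $Q\sim_\varepsilon 0$ for all unmatched $Q$ in $B(M)$ or $B(N)$. $d_B(M,N)=\inf\{\varepsilon\ge0\mid\text{there is an }\varepsilon\text{-matching between }M\text{ and }N\}\in[0,\infty]$. Pruning: for $\varepsilon\ge 0$ let $I$ be the largest submodule of $M$ such that $f(I)\subseteq M_{0\to2\varepsilon}(I)$ for every morphism $f:M\to M(2\varepsilon)$, and let $K$ be the smallest submodule of $I$ such that $(I_{0\to2\varepsilon})^{-1}(f(K))\subseteq K$ for every morphism $f:M\to M(2\varepsilon)$ (both exist). The $\varepsilon$-pruning of $M$ is $\mathrm{Pru}_\varepsilon(M):=(I/K)(-\varepsilon)$. Refinement: a subquotient of $M$ is a module isomorphic to $I'/K'$ for submodules $K'\subseteq I'\subseteq M$. An $\infty$-refinement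 of $M\cong\bigoplus_{i\in I}M_i$ (each $M_i$ indecomposable) is a module isomorphic to some $\bigoplus_{i\in I}N_i$ with each $N_i$ a (possibly zero) subquotient of $M_i$. Pruning distance: for pfd $M,N$, $d_P(M,N)$ is the infimum in $[0,\infty]$ of all $\varepsilon\ge0$ such that for every $\delta\ge0$, $\mathrm{Pru}_{\varepsilon+\delta}(M)$ is an $\infty$-refinement of $\mathrm{Pru}_\delta(N)$ and $\mathrm{Pru}_{\varepsilon+\delta}(N)$ is an $\infty$-refinement of $\mathrm{Pru}_\delta(M)$. *)

(* Defs.v *)
From HB Require Import structures.
From mathcomp Require Import all_boot all_order all_algebra.
From mathcomp Require Import all_classical all_reals ereal.

Set Implicit Arguments.
Unset Strict Implicit.
Unset Printing Implicit Defensive.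

Import Order.TTheory GRing.Theory Num.Theory.
Local Open Scope classical_set_scope.
Local Open Scope ring_scope.
Local Open Scope quotient_scope.

Section LinearAlgebra.
Variable k : fieldType.

Definition has_dim (V : lmodType k) (n : nat) : Prop :=
  inhabited (Vector.axiom n V).

Definition dim_le (V : lmodType k) (r : nat) : Prop :=
  exists2 n : nat, (n <= r)%N & has_dim V n.

Record linsub (V : lmodType k) := LinSub {
  linsub_set :> V -> Prop;
  linsub0 : linsub_set 0;
  linsubP : forall (a : k) (u v : V),
    linsub_set u -> linsub_set v -> linsub_set (a *: u + v) }.

Section SubQuotient.
Variables (V : lmodType k) (S : linsub V).

Lemma linsubZ (a : k) (u : V) : S u -> S (a *: u).
Proof. by move=> Su; rewrite -[a *: u]addr0; apply: linsubP => //; apply: linsub0. Qed.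

Lemma linsubD (u v : V) : S u -> S v -> S (u + v).
Proof. by move=> Su Sv; rewrite -[u]scale1r; apply: linsubP. Qed.

Definition linsub_pred : {pred V} := fun x => `[< linsub_set S x >].

Lemma linsub_predP (x : V) : reflect (S x) (x \in linsub_pred).
Proof. exact: asboolP. Qed.

Lemma linsub_closed : GRing.submod_closed linsub_pred.
Proof.
split=> [|a u v]; first by apply/asboolP; exact: linsub0.
by move=> /asboolP Su /asboolP Sv; apply/asboolP; exact: linsubP.
Qed.

HB.instance Definition _ := GRing.isSubmodClosed.Build k V linsub_pred
  (GRing.submod_closed_semi linsub_closed).

Definition linsub_type := {x : V | x \in linsub_pred}.
HB.instance Definition _ := SubChoice.on linsub_type.
HB.instance Definition _ := [SubChoice_isSubLmodule of linsub_type by <:].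

Definition lquot := Quotient.quot linsub_pred.
HB.instance Definition _ := GRing.Zmodule.on lquot.
HB.instance Definition _ := Quotient.on lquot.

Definition lquot_pi (x : V) : lquot := \pi_lquot x.

Lemma lquot_piP (x y : V) : lquot_pi x = lquot_pi y <-> S (x - y).
Proof.
split=> [/eqP|Sxy].
  by rewrite -Quotient.idealrBE => /asboolP.
by apply/eqP; rewrite -Quotient.idealrBE; apply/asboolP.
Qed.

Lemma lquot_piK (x : lquot) : lquot_pi (repr x) = x.
Proof. exact: reprK. Qed.

Lemma lquot_reprB (x : V) : S (repr (lquot_pi x) - x).
Proof. by apply/lquot_piP; rewrite lquot_piK. Qed.

Lemma lquot_piD (x y : V) : lquot_pi (x + y) = lquot_pi x + lquot_pi y.
Proof. exact: (raddfD (\pi_(Quotient.quot linsub_pred))). Qed.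

Definition lquot_scale (a : k) (x : lquot) : lquot := lquot_pi (a *: repr x).

Lemma lquot_pi_scale (a : k) (x : V) :
  lquot_pi (a *: x) = lquot_scale a (lquot_pi x).
Proof.
apply/esym/lquot_piP; rewrite -scalerBr; apply: linsubZ; exact: lquot_reprB.
Qed.

Lemma lquot_scaleA a b x :
  lquot_scale a (lquot_scale b x) = lquot_scale (a * b) x.
Proof. by rewrite -[x]lquot_piK -!lquot_pi_scale scalerA. Qed.

Lemma lquot_scale1 : left_id 1 lquot_scale.
Proof. by move=> x; rewrite -[x]lquot_piK -!lquot_pi_scale scale1r. Qed.

Lemma lquot_scaleDr : right_distributive lquot_scale +%R.
Proof.
move=> a x y; rewrite -[x]lquot_piK -[y]lquot_piK -lquot_piD -!lquot_pi_scale.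
by rewrite scalerDr lquot_piD.
Qed.

Lemma lquot_scaleDl x : {morph lquot_scale^~ x : a b / a + b}.
Proof.
move=> a b; rewrite -[x]lquot_piK -!lquot_pi_scale.
by rewrite scalerDl lquot_piD.
Qed.

HB.instance Definition _ := GRing.Zmodule_isLmodule.Build k lquot
  lquot_scaleA lquot_scale1 lquot_scaleDr lquot_scaleDl.

Lemma lquot_piZ (a : k) (x : V) : lquot_pi (a *: x) = a *: lquot_pi x.
Proof. exact: lquot_pi_scale. Qed.

End SubQuotient.

Section DirectSum.
Variables (I : Type) (V : I -> lmodType k).

Definition dprod := forall i, V i.
HB.instance Definition _ := gen_eqMixin dprod.
HB.instance Definition _ := gen_choiceMixin dprod.

Definition dprod_add (f g : dprod) : dprod := fun i => f i + g i.
Definition dprod_zero : dprod := fun i => 0.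
Definition dprod_opp (f : dprod) : dprod := fun i => - f i.
Definition dprod_scale (a : k) (f : dprod) : dprod := fun i => a *: f i.

Lemma dprod_addA : associative dprod_add.
Proof. by move=> f g h; apply/functional_extensionality_dep => i; apply: addrA. Qed.
Lemma dprod_addC : commutative dprod_add.
Proof. by move=> f g; apply/functional_extensionality_dep => i; apply: addrC. Qed.
Lemma dprod_add0 : left_id dprod_zero dprod_add.
Proof. by move=> f; apply/functional_extensionality_dep => i; apply: add0r. Qed.
Lemma dprod_addN : left_inverse dprod_zero dprod_opp dprod_add.
Proof. by move=> f; apply/functional_extensionality_dep => i; apply: addNr. Qed.

HB.instance Definition _ := GRing.isZmodule.Build dprod
  dprod_addA dprod_addC dprod_add0 dprod_addN.

Lemma dprod_scaleA a b f :
  dprod_scale a (dprod_scale b f) = dprod_scale (a * b) f.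
Proof. by apply/functional_extensionality_dep => i; apply: scalerA. Qed.
Lemma dprod_scale1 : left_id 1 dprod_scale.
Proof. by move=> f; apply/functional_extensionality_dep => i; apply: scale1r. Qed.
Lemma dprod_scaleDr : right_distributive dprod_scale +%R.
Proof. by move=> a f g; apply/functional_extensionality_dep => i; apply: scalerDr. Qed.
Lemma dprod_scaleDl f : {morph dprod_scale^~ f : a b / a + b}.
Proof. by move=> a b; apply/functional_extensionality_dep => i; apply: scalerDl. Qed.

HB.instance Definition _ := GRing.Zmodule_isLmodule.Build k dprod
  dprod_scaleA dprod_scale1 dprod_scaleDr dprod_scaleDl.

Definition fin_supp (f : dprod) : Prop := finite_set [set i | f i <> 0].

Lemma fin_supp0 : fin_supp 0.
Proof.
by rewrite /fin_supp (_ : [set _ | _] = set0) // -subset0 => i /(_ erefl).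
Qed.

Lemma fin_suppP (a : k) (f g : dprod) :
  fin_supp f -> fin_supp g -> fin_supp (a *: f + g).
Proof.
move=> ff fg; apply: (@sub_finite_set _ _ ([set i | f i <> 0] `|` [set i | g i <> 0])).
  move=> i /= fgi; case: (pselect (f i = 0)) => [fi|]; last by left.
  right => gi; apply: fgi.
  by change (a *: f i + g i = 0); rewrite fi gi scaler0 addr0.
by rewrite finite_setU.
Qed.

Definition fin_supp_linsub : linsub dprod := LinSub fin_supp0 fin_suppP.

Definition lsum : lmodType k := linsub_type fin_supp_linsub.

Definition lsum_coord (f : lsum) (i : I) : V i := val f i.

Lemma lsum_coord_fin (f : lsum) : fin_supp (lsum_coord f).
Proof. exact/asboolP/(valP f). Qed.

Definition mk_lsum (f : dprod) (ff : fin_supp f) : lsum :=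
  exist _ f (introT (@linsub_predP _ fin_supp_linsub f) ff).

Lemma lsumP (f g : lsum) : (forall i, lsum_coord f i = lsum_coord g i) -> f = g.
Proof.
by move=> fg; apply/val_inj/functional_extensionality_dep => i; apply: fg.
Qed.

End DirectSum.

End LinearAlgebra.

Definition mk_linear (k : fieldType) (U V : lmodType k) (f : U -> V)
  (fP : linear f) : {linear U -> V} :=
  HB.pack f (GRing.isLinear.Build k U V *:%R f fP).

Section Persistence.
Variables (k : fieldType) (R : realType) (d : nat).

(* Functions are ordered pointwise, so [(p <= q)%O] is the product order. *)
Definition Rd := 'I_d -> R.
HB.instance Definition _ := Order.POrder.on Rd.

Lemma RdleP (p q : Rd) : reflect (forall i, p i <= q i) (p <= q)%O.
Proof. exact: lefP. Qed.

Definition translate (p : Rd) (e : R) : Rd := fun i => p i + e.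

Lemma translate_mono (p q : Rd) (e : R) :
  (p <= q)%O -> (translate p e <= translate q e)%O.
Proof. by move=> /RdleP pq; apply/RdleP => i; rewrite lerD2r. Qed.

Lemma le_translate (p : Rd) (e : R) : 0 <= e -> (p <= translate p e)%O.
Proof. by move=> e0; apply/RdleP => i; rewrite lerDl. Qed.

Lemma le_translate2 (p : Rd) (e : R) :
  0 <= e -> (p <= translate (translate p e) e)%O.
Proof. by move=> e0; apply: le_trans (le_translate _ e0); apply: le_translate. Qed.

Lemma double_ge0 (e : R) : 0 <= e -> 0 <= 2 * e.
Proof. by move=> e0; rewrite mulr_ge0. Qed.

Record pmod := PMod {
  pspace :> Rd -> lmodType k;
  pmap : forall p q : Rd, (p <= q)%O -> {linear pspace p -> pspace q};
  pmap_id : forall (p : Rd) (h : (p <= p)%O) (x : pspace p), pmap h x = x;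
  pmap_comp : forall (p q r : Rd) (hpq : (p <= q)%O) (hqr : (q <= r)%O)
    (hpr : (p <= r)%O) (x : pspace p), pmap hqr (pmap hpq x) = pmap hpr x }.

Arguments pmap M {p q} h : rename.

Record pmor (M N : pmod) := PMor {
  pmor_at :> forall p : Rd, {linear M p -> N p};
  pmor_natural : forall (p q : Rd) (h : (p <= q)%O) (x : M p),
    pmor_at q (pmap M h x) = pmap N h (pmor_at p x) }.

Definition isom (M N : pmod) : Prop :=
  exists (f : pmor M N) (g : pmor N M),
    forall p : Rd, cancel (f p) (g p) /\ cancel (g p) (f p).

Definition is_zero (M : pmod) : Prop := forall (p : Rd) (x : M p), x = 0.

Definition shift (M : pmod) (e : R) : pmod := {|
  pspace := fun p => M (translate p e);
  pmap := fun p q h => pmap M (translate_mono e h);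
  pmap_id := fun p h x => pmap_id (translate_mono e h) x;
  pmap_comp := fun p q r hpq hqr hpr x =>
    pmap_comp (translate_mono e hpq) (translate_mono e hqr)
      (translate_mono e hpr) x |}.

(* M_{0 -> e}, with M(0) identified with M *)
Program Definition shift_mor (M : pmod) (e : R) (he : 0 <= e) :
  pmor M (shift M e) :=
  @PMor M (shift M e) (fun p => pmap M (le_translate p he)) _.
Next Obligation.
move=> M e he p q h x /=.
have hpq : (p <= translate q e)%O by apply: le_trans h (le_translate _ he).
by rewrite (pmap_comp _ _ hpq) (pmap_comp _ _ hpq).
Qed.

Program Definition zero_pmod : pmod :=
  @PMod (fun=> 'rV[k]_0) (fun p q _ => idfun) _ _.
Next Obligation. by []. Qed.
Next Obligation. by []. Qed.

Record submod (M : pmod) := SubMod {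
  submod_at :> forall p : Rd, linsub (M p);
  submod_map : forall (p q : Rd) (h : (p <= q)%O) (x : M p),
    submod_at p x -> submod_at q (pmap M h x) }.

Definition submod_le (M : pmod) (S T : submod M) : Prop :=
  forall (p : Rd) (x : M p), S p x -> T p x.

Section SubQuotientModule.
Variables (M : pmod) (S : submod M).

Definition sub_map_fun (p q : Rd) (h : (p <= q)%O)
    (x : linsub_type (S p)) : linsub_type (S q) :=
  exist _ (pmap M h (val x))
    (introT (linsub_predP _ _) (submod_map h (elimT (linsub_predP _ _) (valP x)))).

Lemma sub_map_linear p q h : linear (@sub_map_fun p q h).
Proof. by move=> a x y; apply: val_inj; rewrite /= !linearP. Qed.

Program Definition sub_pmod : pmod :=
  @PMod (fun p => linsub_type (S p))
    (fun p q h => mk_linear (@sub_map_linear p q h)) _ _.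
Next Obligation. by move=> p h x; apply: val_inj; apply: pmap_id. Qed.
Next Obligation. by move=> *; apply: val_inj; apply: pmap_comp. Qed.

Definition quot_map_fun (p q : Rd) (h : (p <= q)%O)
    (x : lquot (S p)) : lquot (S q) :=
  lquot_pi (S q) (pmap M h (repr x)).

Lemma quot_map_pi p q (h : (p <= q)%O) (x : M p) :
  quot_map_fun h (lquot_pi (S p) x) = lquot_pi (S q) (pmap M h x).
Proof.
apply/lquot_piP; rewrite -linearB; apply: submod_map; exact: lquot_reprB.
Qed.

Lemma quot_map_linear p q h : linear (@quot_map_fun p q h).
Proof.
move=> a x y; rewrite -[x]lquot_piK -[y]lquot_piK -lquot_piZ -lquot_piD.
by rewrite !quot_map_pi linearP lquot_piD lquot_piZ.
Qed.

Program Definition quot_pmod : pmod :=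
  @PMod (fun p => lquot (S p))
    (fun p q h => mk_linear (@quot_map_linear p q h)) _ _.
Next Obligation.
by move=> p h x /=; rewrite -[x]lquot_piK quot_map_pi pmap_id.
Qed.
Next Obligation.
move=> p q r hpq hqr hpr x /=.
by rewrite -[x]lquot_piK !quot_map_pi (pmap_comp _ _ hpr).
Qed.

End SubQuotientModule.

(* [restrict_submod] is K as a submodule of I, and [quot_sub] is I/K; this is
   used for K contained in I. *)
Section Restrict.
Variables (M : pmod) (I K : submod M).

Program Definition restrict_linsub (p : Rd) : linsub (sub_pmod I p) :=
  @LinSub k (sub_pmod I p) (fun x => K p (val x)) _ _.
Next Obligation. by move=> p; apply: linsub0. Qed.
Next Obligation. by move=> p a u v; apply: linsubP. Qed.

Program Definition restrict_submod : submod (sub_pmod I) :=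
  @SubMod (sub_pmod I) restrict_linsub _.
Next Obligation. by move=> p q h x; apply: submod_map. Qed.

Definition quot_sub : pmod := quot_pmod restrict_submod.
End Restrict.

Section Intersection.
Variables (M : pmod) (F : submod M -> Prop).

Program Definition inf_linsub (p : Rd) : linsub (M p) :=
  @LinSub k (M p) (fun x => forall S : submod M, F S -> S p x) _ _.
Next Obligation. by move=> p S FS; apply: linsub0. Qed.
Next Obligation.
by move=> p a u v Fu Fv S FS; apply: linsubP; [apply: Fu|apply: Fv].
Qed.

Program Definition inf_submod : submod M := @SubMod M inf_linsub _.
Next Obligation. by move=> p q h x Fx S FS; apply/submod_map/Fx. Qed.

Lemma inf_submod_lb S : F S -> submod_le inf_submod S.
Proof. by move=> FS p x; apply. Qed.

Lemma inf_submod_glb T :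
  (forall S, F S -> submod_le T S) -> submod_le T inf_submod.
Proof. by move=> h p x Tx S FS; apply: h. Qed.
End Intersection.

(* The sum of the submodules in F, as the smallest submodule containing them *)
Section Sum.
Variables (M : pmod) (F : submod M -> Prop).

Definition sup_submod : submod M :=
  inf_submod (fun T => forall S, F S -> submod_le S T).

Lemma sup_submod_ub S : F S -> submod_le S sup_submod.
Proof. by move=> FS; apply: inf_submod_glb => T; apply. Qed.

Lemma sup_submod_lub T :
  (forall S, F S -> submod_le S T) -> submod_le sup_submod T.
Proof. exact: inf_submod_lb. Qed.
End Sum.

(* f^-1(g(S)) *)
Section Preimage.
Variables (M N : pmod) (f g : pmor M N) (S : submod M).

Program Definition preim_linsub (p : Rd) : linsub (M p) :=
  @LinSub k (M p) (f p @^-1` (g p @` S p)) _ _.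
Next Obligation. by move=> p; exists 0; [exact: linsub0|rewrite !linear0]. Qed.
Next Obligation.
move=> p a u v [x Sx fx] [y Sy fy]; exists (a *: x + y); first exact: linsubP.
by rewrite !linearP fx fy.
Qed.

Program Definition preim_submod : submod M := @SubMod M preim_linsub _.
Next Obligation.
move=> p q h x [y Sy fy]; exists (pmap M h y); first exact: submod_map.
by rewrite !pmor_natural fy.
Qed.
End Preimage.

Section DirectSumModule.
Variables (I : Type) (F : I -> pmod).

Let V (p : Rd) (i : I) : lmodType k := F i p.

Lemma dsum_map_fin (p q : Rd) (h : (p <= q)%O) (x : lsum (V p)) :
  fin_supp (fun i => pmap (F i) h (lsum_coord x i) : V q i).
Proof.
apply: sub_finite_set (lsum_coord_fin x) => i /= + x0; apply.
by rewrite x0 linear0.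
Qed.

Definition dsum_map_fun (p q : Rd) (h : (p <= q)%O) (x : lsum (V p)) :
  lsum (V q) := mk_lsum (dsum_map_fin h x).

Lemma dsum_map_linear p q h : linear (@dsum_map_fun p q h).
Proof. by move=> a x y; apply: lsumP => i; apply: linearP. Qed.

Program Definition dsum : pmod :=
  @PMod (fun p => lsum (V p))
    (fun p q h => mk_linear (@dsum_map_linear p q h)) _ _.
Next Obligation. by move=> p h x; apply: lsumP => i; apply: pmap_id. Qed.
Next Obligation. by move=> *; apply: lsumP => i; apply: pmap_comp. Qed.
End DirectSumModule.

Definition indecomposable (M : pmod) : Prop :=
  ~ is_zero M /\
  forall F : bool -> pmod, isom M (dsum F) ->
    is_zero (F true) \/ is_zero (F false).

Record upset := Upset {
  upset_set :> Rd -> Prop;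
  upsetP : forall p q : Rd, upset_set p -> (p <= q)%O -> upset_set q }.

Section UpsetModule.
Variable U : upset.

Definition upset_space (b : bool) : lmodType k :=
  if b then (k^o : lmodType k) else ('rV[k]_0 : lmodType k).

Definition upset_map (b c : bool) : {linear upset_space b -> upset_space c} :=
  match b, c return {linear upset_space b -> upset_space c} with
  | true, true => idfun
  | _, _ => \0
  end.

Program Definition upset_pmod : pmod :=
  @PMod (fun p => upset_space `[< U p >])
    (fun p q _ => upset_map `[< U p >] `[< U q >]) _ _.
Next Obligation.
move=> p h /=; case: `[< U p >] => //= x.
by apply/matrixP => i [].
Qed.
Next Obligation.
move=> p q r hpq hqr hpr x.
have : `[< U p >] -> `[< U q >].
  by move=> /asboolP Up; apply/asboolP; apply: upsetP hpq.
by move: x; case: `[< U p >]; case: `[< U q >]; case: `[< U r >] => //= x /(_ isT).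
Qed.
End UpsetModule.

Definition upset_decomposable (M : pmod) : Prop :=
  exists (I : Type) (U : I -> upset), isom M (dsum (fun i => upset_pmod (U i))).

(* [translate (translate p e) e] and [translate p (2 * e)] are equal but not
   convertible; M(e)(e) stands for M(2e). *)
Definition interleaved (e : R) (he : 0 <= e) (M N : pmod) : Prop :=
  exists (phi : pmor M (shift N e)) (psi : pmor N (shift M e)),
    (forall (p : Rd) (x : M p),
       psi (translate p e) (phi p x) = pmap M (le_translate2 p he) x) /\
    (forall (p : Rd) (x : N p),
       phi (translate p e) (psi p x) = pmap N (le_translate2 p he) x).

(* The isomorphism classes of the Q i, indexed by I, form the multiset B(M),
   whose sub-multisets are given by subsets of I.  By uniqueness of the
   decomposition of a pointwise finite-dimensional module, quantifying
   existentially over such families is independent of the choice. *)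
Definition is_barcode (M : pmod) (I : Type) (Q : I -> pmod) : Prop :=
  (forall i, indecomposable (Q i)) /\ isom M (dsum Q).

Definition eps_matching (e : R) (he : 0 <= e) (M N : pmod) : Prop :=
  exists (I J : Type) (P : I -> pmod) (Q : J -> pmod),
    [/\ is_barcode M P, is_barcode N Q &
      exists (A : set I) (B : set J) (s : A -> B),
        [/\ bijective s,
            forall a : A, interleaved he (P (sval a)) (Q (sval (s a))),
            forall i : I, ~ A i -> interleaved he (P i) zero_pmod &
            forall j : J, ~ B j -> interleaved he (Q j) zero_pmod]].

Definition dB (M N : pmod) : \bar R :=
  ereal_inf [set e%:E | e in
    [set e : R | exists he : 0 <= e, eps_matching he M N]].

Section Pruning.
Variables (e : R) (he : 0 <= e) (M : pmod).

Let M02e : pmor M (shift M (2 * e)) := shift_mor M (double_ge0 he).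

Definition pru_I_cond (S : submod M) : Prop :=
  forall (f : pmor M (shift M (2 * e))) (p : Rd),
    f p @` S p `<=` M02e p @` S p.

Definition pru_I : submod M := sup_submod pru_I_cond.

Lemma pru_I_condP : pru_I_cond pru_I.
Proof.
move=> f p _ [x Ix <-].
apply: (sup_submod_lub (T := preim_submod f M02e pru_I) _ Ix) => S HS q y Sy.
have [z Sz fz] := HS f q _ (imageP _ Sy).
by exists z => //; apply: sup_submod_ub Sz.
Qed.

Lemma pru_I_largest (S : submod M) : pru_I_cond S -> submod_le S pru_I.
Proof. exact: sup_submod_ub. Qed.

(* [M02e p] restricted to [pru_I p] is the map I_{0 -> 2e} at p. *)
Definition pru_K_cond (K : submod M) : Prop :=
  submod_le K pru_I /\
  forall (f : pmor M (shift M (2 * e))) (p : Rd),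
    pru_I p `&` M02e p @^-1` (f p @` K p) `<=` K p.

Definition pru_K : submod M := inf_submod pru_K_cond.

Lemma pru_K_condP : pru_K_cond pru_K.
Proof.
have condI : pru_K_cond pru_I by split=> // f p x [].
split; first exact: inf_submod_lb.
move=> f p x [Ix [y Ky fy]] K HK; apply: (HK.2 f); split=> //.
by exists y => //; apply: Ky.
Qed.

Lemma pru_K_smallest (K : submod M) : pru_K_cond K -> submod_le pru_K K.
Proof. exact: inf_submod_lb. Qed.

Definition Pru : pmod := shift (quot_sub pru_I pru_K) (- e).
End Pruning.

Definition subquotient (Q M : pmod) : Prop :=
  exists I K : submod M, submod_le K I /\ isom Q (quot_sub I K).

Definition infty_refinement (Q M : pmod) : Prop :=
  exists (I : Type) (P N : I -> pmod),
    [/\ is_barcode M P,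
        forall i, subquotient (N i) (P i) &
        isom Q (dsum N)].

Definition dP (M N : pmod) : \bar R :=
  ereal_inf [set e%:E | e in
    [set e : R | exists he : 0 <= e, forall (c : R) (hc : 0 <= c),
      infty_refinement (Pru (addr_ge0 he hc) M) (Pru hc N) /\
      infty_refinement (Pru (addr_ge0 he hc) N) (Pru hc M)]].

End Persistence.

Arguments pmap {k R d} M {p q} h : rename.

(* Main.v *)
From mathcomp Require Import all_boot all_order all_algebra perm.
From mathcomp Require Import all_classical all_reals ereal.
From mathcomp Require Import zify ring lra.
Require Import Defs.

(** Any two nonempty upsets of R^d meet, so a module as in the theorem is a
    direct sum of k_(U_1), ..., k_(U_n) with n <= r.  Such a module is
    described by coordinates, called a frame below: natural injective linear
    maps chi_p : M_p -> k^n whose image at p is spanned by the basis vectors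
    e_a with p in U_a.  All transition maps become inclusions of coordinate
    subspaces of k^n, and a morphism between two framed modules is a constant
    matrix A whose entry A_ab may be nonzero only if U_a is contained in V_b
    ([matrix_of_morphism], [morphism_of_matrix]).  This reduces everything to
    the combinatorics of two finite families of upsets.

    Barcodes.  By the exchange argument of Krull, Schmidt and Azumaya, carried
    out with the endomorphism rings End(k_U) = k, every decomposition of a
    framed module into indecomposables consists of the k_(U_a)
    ([krull_schmidt]).  Since k_U and k_V are e-interleaved exactly when U is
    contained in V(e) and V in U(e), and no nonzero k_U is interleaved with 0,
    an e-matching is a bijection of the two families under which corresponding
    upsets are contained in each other up to e.

    Prunings.  The maps M_(0->2e) are injective, so K = 0, and I_p is the
    largest subspace of M_p stable under the elementary matrices E_ab with U_a
    contained in U_b(2e).  Hence I is the sum of the k_(core a), where core a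
    is the intersection of the U_b for b reachable from a by steps of length
    2e, and the e-pruning is framed by the upsets prune e U a, the translates
    of the cores ([frame_Pru]).  As all maps in a pruning are injective, a
    refinement of one pruning by another is an injection of the index sets
    which enlarges upsets ([injection_of_refinement]): the matrix of the given
    isomorphism at one point has linearly independent rows, so some maximal
    minor, and then some term of its Leibniz expansion, is nonzero.

    The inequality d_P <= d_B.  Passing from U to V along an e-matching turns
    2c-steps into 2(e + c)-steps, so the core for e + c is an intersection over
    more indices of sets which are smaller up to e ([prune_within]).

    The inequality d_B <= (2r - 1) d_P.  For delta = 0, the
    refinements yield injections sigma and tau with prune e U a inside
    V_(sigma a) and prune e V b inside U_(tau b).  As at most n - 1 steps are
    needed to reach everything reachable from a, U_a lies in V_(sigma a) up to
    2(n - 1)e + e.  For the converse containment ([backward_within]) one does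
    not follow the cycle of tau o sigma, since the errors of a full turn add up
    to too much.  Instead a set A of indices reached from v = sigma a is grown,
    at a total cost of 2e per new index: transport A by tau and close up to get
    B; if a is in B, the cost is at most (2n - 1)e; otherwise v is not in
    sigma(B), so that A u sigma(B) has at least |B| + 1 elements, and this
    additional element pays for the round trip. *)

Set Implicit Arguments.
Unset Strict Implicit.
Unset Printing Implicit Defensive.

Import Order.TTheory GRing.Theory Num.Theory.

(** * Families of upsets *)

Section Upsets.
Local Open Scope ring_scope.
Variables (R : realType) (d : nat).
Implicit Types (p q : Rd R d) (s t : R) (W X Y : upset R d).

Definition pt_max p q : Rd R d := fun i => Num.max (p i) (q i).

Lemma le_maxl p q : (p <= pt_max p q)%O.
Proof. by apply/RdleP => i; rewrite le_max lexx. Qed.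

Lemma le_maxr p q : (q <= pt_max p q)%O.
Proof. by apply/RdleP => i; rewrite le_max lexx orbT. Qed.

Lemma translateD p s t : translate (translate p s) t = translate p (s + t).
Proof. by apply/funext => i; rewrite /translate addrA. Qed.

Lemma translate0 p : translate p 0 = p.
Proof. by apply/funext => i; rewrite /translate addr0. Qed.

Lemma translate_le p s t : s <= t -> (translate p s <= translate p t)%O.
Proof. by move=> st; apply/RdleP => i; rewrite lerD2l. Qed.

Definition nonempty W := exists p, W p.

(** Any two points have an upper bound.  This is why only finitely many nonempty
    upsets can occur in a module of bounded dimension. *)
Lemma common_point n (U : 'I_n -> upset R d) :
  (forall a, nonempty (U a)) -> exists p, forall a, U a p.
Proof.
elim: n U => [|n IH] U hU; first by exists (fun=> 0) => -[].
have [p hp] := IH (fun a => U (lift ord0 a)) (fun a => hU _).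
have [q hq] := hU ord0.
exists (pt_max p q) => a; case: (unliftP ord0 a) => [b|] ->.
  exact: upsetP (hp b) (le_maxl _ _).
exact: upsetP hq (le_maxr _ _).
Qed.

Program Definition shift_upset t W : upset R d :=
  @Upset R d (fun p => W (translate p t)) _.
Next Obligation. by move=> t W p q Wp pq; apply: upsetP Wp (translate_mono t pq). Qed.

Lemma shift_upset_nonempty t W : nonempty W -> nonempty (shift_upset t W).
Proof.
by move=> [p Wp]; exists (translate p (- t)); rewrite /= translateD addNr translate0.
Qed.

(** W is contained in X(t). *)
Definition within t W X := forall p, W p -> X (translate p t).

Lemma within_trans s t W X Y : within s W X -> within t X Y -> within (s + t) W Y.
Proof. by move=> WX XY p /WX /XY; rewrite translateD. Qed.

Lemma within_le s t W X : s <= t -> within s W X -> within t W X.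
Proof. by move=> st WX p /WX Xp; apply: upsetP Xp (translate_le _ st). Qed.

Lemma within_refl t W : 0 <= t -> within t W W.
Proof. by move=> t0 p Wp; apply: upsetP Wp (le_translate _ t0). Qed.

Section Pruning.
Variable n : nat.
Implicit Types (A B : {set 'I_n}) (U V : 'I_n -> upset R d).

Definition closed_under t U A :=
  forall a b, a \in A -> within t (U a) (U b) -> b \in A.

(** The closed sets with respect to t are the unions of the sets of indices
    reachable by steps of length t, so core t U a is the intersection of the U b
    over all b reachable from a. *)
Program Definition core t U (a : 'I_n) : upset R d :=
  @Upset R d (fun p => exists A, [/\ closed_under t U A, a \in A &
                                  forall b, b \in A -> U b p]) _.
Next Obligation.
by move=> t U a p q [A [cA aA hA]] pq; exists A; split=> // b /hA Ub; apply: upsetP pq.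
Qed.

Definition prune e U a := shift_upset (- e) (core (2 * e) U a).

Lemma core_sub t U a p : core t U a p -> U a p.
Proof. by move=> [A [_ aA]]; apply. Qed.

Lemma prune_nonempty e U a : (forall b, nonempty (U b)) -> nonempty (prune e U a).
Proof.
move=> hU; apply: shift_upset_nonempty; have [p hp] := common_point hU.
by exists p; exists [set: 'I_n]; split=> [b c _ _||b _]; rewrite ?inE //; apply: hp.
Qed.

Lemma prune0_sub U a p : prune 0 U a p -> U a p.
Proof. by move=> /core_sub; rewrite oppr0 translate0. Qed.

(** A closed set containing a witnesses membership in the core of a, and the
    shift of the pruning costs e. *)
Lemma within_prune s e U X A a :
    closed_under (2 * e) U A -> a \in A ->
    (forall b, b \in A -> within s X (U b)) ->
  within (s + e) X (prune e U a).
Proof.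
move=> cA aA XU p Xp; exists A; split=> // b bA.
by rewrite translateD addrK; apply: XU.
Qed.

(** The families are e-matched, so a 2c-step from b to b' in V gives a step
    U b -> V b -> V b' -> U b' of length 2(e + c): closed sets for U at scale
    e + c are closed for V at scale c. *)
Lemma prune_within e c U V a p :
    0 <= e -> (forall b, within e (U b) (V b)) -> (forall b, within e (V b) (U b)) ->
  prune (e + c) U a p -> prune c V a p.
Proof.
move=> e0 UV VU [A [cA aA hA]]; exists A; split=> //.
  move=> b b' bA Vbb'; apply: (cA b) => //.
  have -> : 2 * (e + c) = e + 2 * c + e by ring.
  exact: within_trans (within_trans (UV b) Vbb') (VU b').
by move=> b /hA /UV; rewrite translateD opprD addrAC addNr add0r.
Qed.

(** Indices are added one at a time, each by one step of length t from an index
    already present; hence the cost counts the m new indices, and does not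
    involve the length of paths. *)
Lemma closure_cost t s U X A : 0 <= t ->
    (forall a, a \in A -> within s X (U a)) ->
  exists B m, [/\ A \subset B, closed_under t U B, #|B| = (#|A| + m)%N &
    forall b, b \in B -> within (s + t * m%:R) X (U b)].
Proof.
move=> t0; have [N] := ubnP #|~: A|; elim: N A s => // N IH A s hN XA.
have [cA|] := pselect (closed_under t U A).
  by exists A, 0%N; rewrite mulr0 addr0 addn0; split.
move=> /existsNP[a /existsNP[b /not_implyP[aA /not_implyP[ab bA]]]].
move/negP: bA => bA.
have cU : #|b |: A| = #|A|.+1 by rewrite cardsU1 bA.
case: (IH (b |: A) (s + t)) => [|c|B [m [AB cB hB XB]]].
- have := cardsC A; have := cardsC (b |: A); rewrite cU => <- /eqP.
  by rewrite addSn -addnS eqn_add2l => /eqP h; rewrite h ltnS in hN.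
- rewrite in_setU1 => /orP[/eqP->|cA]; first exact: within_trans (XA _ aA) ab.
  by apply: within_le (XA _ cA); rewrite lerDl.
exists B, m.+1; split=> //.
- by apply: fintype.subset_trans AB; apply: finset.subsetUr.
- by rewrite hB cU addSnnS.
- by move=> c /XB; congr (within _ _ _); rewrite -natr1; ring.
Qed.

End Pruning.

(** The closure of {a} is reached by at most n - 1 steps of length 2e; entering
    the pruning costs another e. *)
Lemma forward_within n e (U : 'I_n -> upset R d) (a : 'I_n) X : 0 <= e ->
    (forall p, prune e U a p -> X p) ->
  within ((2 * n%:R - 1) * e) (U a) X.
Proof.
move=> e0 sub.
have [|b|B [m [aB cB hB XB]]] :=
  @closure_cost n (2 * e) 0 U (U a) [set a]; first by rewrite mulr_ge0.
  by rewrite finset.in_set1 => /eqP ->; apply: within_refl.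
have aB' : a \in B by rewrite -finset.sub1set.
suff h : within ((2 * n%:R - 1) * e) (U a) (prune e U a) by move=> p /h /sub.
apply: within_le (within_prune cB aB' XB).
have : (m.+1 <= n)%N.
  by move: (max_card (mem B)); rewrite hB cards1 card_ord add1n.
rewrite -(ler_nat R) -natr1 => hm.
have -> : 0 + 2 * e * m%:R + e = (2 * (m%:R + 1) - 1) * e by ring.
by rewrite ler_wpM2r // lerB // ler_wpM2l.
Qed.

(** The invariant of [grow] is a closed set A of indices reached from v at cost
    2e(|A| - 1).  The set B obtained from tau(A) is reached at cost
    2e|B| - e, and sigma(B) at cost 2e|B|.  As long as a is not in B, the index
    v = sigma a lies in A but not in sigma(B), so that A u sigma(B) is larger
    than B and satisfies the invariant again. *)
Lemma backward_within n e (U V : 'I_n -> upset R d) (sigma tau : 'I_n -> 'I_n) :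
    0 <= e -> injective sigma -> injective tau ->
    (forall a p, prune e U a p -> V (sigma a) p) ->
    (forall b p, prune e V b p -> U (tau b) p) ->
  forall a, within ((2 * n%:R - 1) * e) (V (sigma a)) (U a).
Proof.
move=> e0 si ti US VT a; set v := sigma a.
have e20 : 0 <= 2 * e by rewrite mulr_ge0.
have grow (A : {set 'I_n}) m : #|A| = m.+1 -> v \in A -> closed_under (2 * e) V A ->
    (forall b, b \in A -> within (2 * e * m%:R) (V v) (V b)) ->
    within ((2 * n%:R - 1) * e) (V v) (U a).
  have [N] := ubnP (n - m)%N; elim: N A m => // N IH A m hN cA vA clA VA.
  have hB0 b : b \in tau @: A -> within (2 * e * m%:R + e) (V v) (U b).
    move=> /imsetP[b' b'A ->] p Vp.
    by apply: VT; exact: (within_prune clA b'A VA) Vp.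
  have [B [j [B0B clB cB VB]]] := closure_cost e20 hB0.
  rewrite card_imset // cA addSn in cB.
  have lBn : (m + j < n)%N by rewrite -cB -[leqRHS]card_ord max_card.
  (* B has |A| + j = (m + j).+1 elements, and is reached at cost 2e|B| - e. *)
  have cost : 2 * e * m%:R + e + 2 * e * j%:R = (2 * ((m + j).+1)%:R - 1) * e.
    by rewrite -[(m + j).+1%:R]natr1 natrD; ring.
  have [aB|aB] := boolP (a \in B).
    apply: within_le (VB a aB); rewrite cost.
    by rewrite ler_wpM2r // lerB // ler_wpM2l // ler_nat.
  have hC0 c : c \in A :|: sigma @: B -> within (2 * e * (m + j).+1%:R) (V v) (V c).
    rewrite finset.in_setU => /orP[/VA|/imsetP[b bB ->]].
      by apply: within_le; rewrite ler_wpM2l // ler_nat; lia.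
    move=> p Vp; apply: US; have := within_prune clB bB VB Vp.
    by congr (prune _ _ _ (translate _ _)); rewrite cost; ring.
  (* Injectivity of sigma turns a \notin B into v \notin sigma(B). *)
  have vsB : v \notin sigma @: B by rewrite mem_imset.
  have [C [l [C0C clC cC VC]]] := closure_cost e20 hC0.
  have cC0 : ((m + j).+2 <= #|A :|: sigma @: B|)%N.
    rewrite -cB -(card_imset _ si) -[leqLHS]/(1 + _)%N.
    have -> : (1 + #|sigma @: B|)%N = #|v |: sigma @: B| by rewrite cardsU1 vsB.
    by apply/subset_leq_card/finset.setSU; rewrite finset.sub1set.
  have vC : v \in C by apply: (fintype.subsetP C0C); rewrite finset.in_setU vA.
  case E : #|C| cC => [|h] cC; first lia.
  have hmj : ((m + j).+1 + l <= h)%N by lia.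
  apply: (IH C h) => //; first lia.
  move=> c /VC; apply: within_le; rewrite -mulrDr -natrD.
  by rewrite ler_wpM2l // ler_nat.
have [b|A [m [vA clA cA VA]]] := closure_cost (s := 0) (X := V v) (U := V) (A := [set v]) e20.
  by rewrite finset.in_set1 => /eqP ->; apply: within_refl.
apply: (grow A m); [by rewrite cA cards1|by rewrite -finset.sub1set|by []|].
by move=> b /VA; rewrite add0r.
Qed.

End Upsets.

(** * Coordinates on persistence modules *)

Section Modules.
Local Open Scope ring_scope.
Variables (k : fieldType) (R : realType) (d : nat).
Implicit Types (M N L : pmod k R d) (p q : Rd R d) (W X : upset R d).

Program Definition pmor_comp M N P (g : pmor N P) (f : pmor M N) : pmor M P :=
  @PMor k R d M P (fun p => mk_linear (f := fun x => g p (f p x)) _) _.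
Next Obligation. by move=> M N P g f p a x y; rewrite !linearP. Qed.
Next Obligation. by move=> M N P g f p q h x /=; rewrite !pmor_natural. Qed.

Lemma isom_sym M N : isom M N -> isom N M.
Proof. by move=> [f [g fg]]; exists g, f => p; have [] := fg p. Qed.

(** Being an isomorphism can be tested pointwise, because the pointwise inverse
    of a natural map is natural. *)
Lemma isom_of_bij M N (f : pmor M N) :
    (forall p x, f p x = 0 -> x = 0) -> (forall p y, exists x, f p x = y) ->
  isom M N.
Proof.
move=> inj surj.
have injf p x y : f p x = f p y -> x = y.
  by move=> e; apply/eqP; rewrite -subr_eq0; apply/eqP/inj; rewrite linearB e subrr.
pose g p y := sval (cid (surj p y)).
have fK p y : f p (g p y) = y by exact: svalP (cid (surj p y)).
have glin p : linear (g p).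
  by move=> a x y; apply: (injf p); rewrite linearP !fK.
exists f, (@PMor k R d N M (fun p => mk_linear (glin p)) (fun p q h x =>
  injf q _ _ (etrans (fK q _) (esym (etrans (pmor_natural f h _)
    (congr1 (pmap N h) (fK p x))))))) => p.
by split=> x; [apply: (injf p)|]; rewrite /= fK.
Qed.

(** A frame identifies M with the direct sum of the upset modules of the U a,
    as a submodule of the constant module k^n. *)
Record frame n (U : 'I_n -> upset R d) M := Frame {
  frame_at :> forall p, {linear M p -> 'rV[k]_n};
  frame_inj : forall p x, frame_at p x = 0 -> x = 0;
  frame_natural : forall p q (h : (p <= q)%O) x,
    frame_at q (pmap M h x) = frame_at p x;
  frame_supp : forall p x a, frame_at p x 0 a != 0 -> U a p;
  frame_surj : forall p (v : 'rV[k]_n), (forall a, v 0 a != 0 -> U a p) ->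
    exists x, frame_at p x = v }.

Section Frames.
Variables (n : nat) (U : 'I_n -> upset R d) (M : pmod k R d) (F : frame U M).

Lemma frame_eq p (x y : M p) : F p x = F p y -> x = y.
Proof.
by move=> e; apply/eqP; rewrite -subr_eq0; apply/eqP/(frame_inj (f := F)); rewrite linearB e subrr.
Qed.

Lemma frame_map_inj p q (h : (p <= q)%O) (x : M p) : pmap M h x = 0 -> x = 0.
Proof.
by move=> e; apply: (frame_inj (f := F)); rewrite -(frame_natural F h) e linear0.
Qed.

Lemma frame_basis p a : U a p -> exists x, F p x = delta_mx 0 a.
Proof.
move=> Uap; apply: frame_surj => b; rewrite mxE eqxx /=.
by have [->|] := eqVneq b a; rewrite //= eqxx.
Qed.

Lemma frame_isom N : isom N M -> inhabited (frame U N).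
Proof.
move=> [f [g fg]].
have lin p : linear (fun x => F p (f p x)) by move=> a x y; rewrite !linearP.
constructor; apply: (@Frame n U N (fun p => mk_linear (lin p))) => /=.
- move=> p x /(frame_inj (f := F)) /(congr1 (g p)); rewrite linear0.
  by have [-> _] := fg p.
- by move=> p q h x; rewrite pmor_natural frame_natural.
- by move=> p x a; apply: frame_supp.
- move=> p v /(frame_surj F)[y <-]; exists (g p y).
  by have [_ ->] := fg p.
Qed.

Program Definition frame_shift t : frame (fun a => shift_upset t (U a)) (shift M t) :=
  @Frame n (fun a => shift_upset t (U a)) (shift M t) (fun p => F (translate p t)) _ _ _ _.
Next Obligation. by move=> t p x; apply: (frame_inj (f := F)). Qed.
Next Obligation. by move=> t p q h x; apply: (frame_natural F). Qed.
Next Obligation. by move=> t p x a; apply: (frame_supp (f := F)). Qed.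
Next Obligation. by move=> t p v; apply: (frame_surj F). Qed.

Lemma frame_reindex m (s : 'I_m -> 'I_n) s' : cancel s s' -> cancel s' s ->
  inhabited (frame (fun a => U (s a)) M).
Proof.
move=> sK s'K.
have lin p : linear (fun x : M p => \row_a (F p x) 0 (s a)).
  by move=> c x y; apply/rowP => a; rewrite linearP !mxE.
constructor; apply: (@Frame m _ M (fun p => mk_linear (lin p))) => /=.
- move=> p x /rowP h; apply: (frame_inj (f := F)); apply/rowP => a.
  by have := h (s' a); rewrite !mxE s'K.
- by move=> p q h x; rewrite frame_natural.
- by move=> p x a; rewrite mxE; apply: frame_supp.
- move=> p v hv; have [|x hx] := frame_surj F (p := p) (v := \row_b v 0 (s' b)).
    by move=> b; rewrite mxE => /hv; rewrite s'K.
  by exists x; apply/rowP => a; rewrite hx !mxE sK.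
Qed.

End Frames.

Section Morphisms.
Variables (n m : nat) (U : 'I_n -> upset R d) (V : 'I_m -> upset R d).
Variables (M N : pmod k R d) (F : frame U M) (G : frame V N).

Lemma morphism_of_matrix (A : 'M[k]_(n, m)) :
    (forall a b, A a b != 0 -> forall p, U a p -> V b p) ->
  exists f : pmor M N, forall p x, G p (f p x) = F p x *m A.
Proof.
move=> hA.
have ex p (x : M p) : exists y, G p y = F p x *m A.
  apply: frame_surj => b; rewrite mxE => nz.
  have [a ha|h] := pickP (fun a => F p x 0 a * A a b != 0).
    move: ha; rewrite mulf_eq0 => /norP[/frame_supp Ua /hA]; exact.
  by case/eqP: nz; apply: big1 => a _; apply/eqP; rewrite -[_ == _]negbK h.
pose f p x := sval (cid (ex p x)).
have fE p x : G p (f p x) = F p x *m A by exact: svalP (cid (ex p x)).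
have lin p : linear (f p).
  move=> c x y; apply: (frame_eq (F := G)).
  by rewrite linearP !fE linearP mulmxDl scalemxAl.
unshelve eexists (@PMor k R d M N (fun p => mk_linear (lin p)) _) => //.
by move=> p q h x; apply: (frame_eq (F := G)); rewrite /= frame_natural !fE frame_natural.
Qed.

(** The image of the basis vector e_a is the same at all points of U a, because
    any two points lie below a third one.  It is computed at one chosen point,
    and its b-th coordinate can only be nonzero if every point of U a lies in
    V b. *)
Lemma matrix_of_morphism (f : pmor M N) : (forall a, nonempty (U a)) ->
  exists A : 'M[k]_(n, m), (forall p x, G p (f p x) = F p x *m A) /\
    (forall a b, A a b != 0 -> forall p, U a p -> V b p).
Proof.
move=> hU.
pose e a p (h : U a p) := sval (cid (frame_basis F h)).
have eE a p (h : U a p) : F p (e a p h) = delta_mx 0 a.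
  exact: svalP (cid (frame_basis F h)).
pose pt a := sval (cid (hU a)); have ptP a : U a (pt a) := svalP (cid (hU a)).
pose A := \matrix_(a, b) G (pt a) (f _ (e a _ (ptP a))) 0 b.
have AE a p (h : U a p) : G p (f p (e a p h)) = row a A.
  have -> : row a A = G (pt a) (f _ (e a _ (ptP a))) by apply/rowP => b; rewrite !mxE.
  (* e_a at p and e_a at pt a have the same image at the maximum. *)
  have hp := le_maxl p (pt a); have hq := le_maxr p (pt a).
  rewrite -(frame_natural G hp) -(frame_natural G hq) -!pmor_natural.
  congr (G _ (f _ _)); apply: (frame_eq (F := F)).
  by rewrite !frame_natural !eE.
exists A; split=> [p x|a b Aab p Uap].
  have -> : x = \sum_a (if pselect (U a p) is left h then F p x 0 a *: e a p h else 0).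
    apply: (frame_eq (F := F)); rewrite linear_sum.
    rewrite [LHS]row_sum_delta; apply: eq_bigr => a _.
    case: pselect => [h|h]; first by rewrite linearZ eE.
    have [->|/frame_supp //] := eqVneq (F p x 0 a) 0.
    by rewrite scale0r linear0.
  rewrite !linear_sum mulmx_suml; apply: eq_bigr => a _.
  case: pselect => [h|h]; last by rewrite !linear0 mul0mx.
  by rewrite !linearZ /= AE eE -scalemxAl rowE.
have := AE a p Uap => /rowP /(_ b); rewrite mxE => E.
by apply: (frame_supp (f := G) (x := f p (e a p Uap))); rewrite E.
Qed.

End Morphisms.

Lemma isom_of_frames n (U : 'I_n -> upset R d) M N :
  frame U M -> frame U N -> isom M N.
Proof.
move=> F G.
have [a b|f fE] := morphism_of_matrix F G (A := 1%:M).
  by rewrite mxE; have [->|] := eqVneq a b; rewrite //= eqxx.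
apply: (isom_of_bij (f := f)) => p x.
  move=> fx0; apply: (frame_inj (f := F)).
  by rewrite -[F p x]mulmx1 -fE fx0 linear0.
have [a|y hy] := frame_surj F (p := p) (v := G p x); first exact: frame_supp.
by exists y; apply: (frame_eq (F := G)); rewrite fE hy mulmx1.
Qed.

(** For n = 1, a frame identifies M with a single upset module. *)
Definition frame1 W M := frame (fun _ : 'I_1 => W) M.

Lemma upset_frame W : inhabited (frame1 W (upset_pmod k W)).
Proof.
pose u b : upset_space k b -> 'rV[k]_1 :=
  if b is true then fun x : k^o => const_mx (x : k) else fun=> 0.
have ulin b : linear (u b).
  case: b => /= c x y; apply/rowP => j; rewrite ?mxE //.
  by rewrite mulr0 addr0.
have uinj b x : u b x = 0 -> x = 0.
  case: b x => x; last by move=> _; apply/rowP => -[].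
  by move=> /rowP /(_ 0); rewrite !mxE.
have unat (b c : bool) : (b -> c) -> forall x, u c (upset_map k b c x) = u b x.
  by case: b; case: c => // /(_ isT).
have usupp (b : bool) x a : u b x 0 a != 0 -> b.
  by case: b x => //= x; rewrite mxE eqxx.
have usurj (b : bool) (v : 'rV_1) : (v 0 0 != 0 -> b) -> exists x, u b x = v.
  case: b => hv.
    by exists (v 0 0 : k^o); apply/rowP => a; rewrite mxE !ord1.
  exists 0; apply/rowP => a; rewrite mxE !ord1; apply/esym/eqP.
  by apply/negPn/negP => /hv.
constructor; apply: (@Frame 1 _ (upset_pmod k W) (fun p => mk_linear (ulin `[< W p >]))).
- by move=> p x; apply: uinj.
- move=> p q h x; apply: unat.
  by move=> /asboolP Wp; apply/asboolP; apply: upsetP h.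
- by move=> p x a /usupp /asboolP.
- by move=> p v hv; apply: usurj => /hv Wp; apply/asboolP.
Qed.

Lemma dsum_frame n (U : 'I_n -> upset R d) (P : 'I_n -> pmod k R d) :
  (forall a, frame1 (U a) (P a)) -> inhabited (frame U (dsum P)).
Proof.
move=> F.
have lin p : linear (fun x : dsum P p => \row_a (F a p (lsum_coord x a)) 0 0).
  move=> c x y; apply/rowP => a; rewrite !mxE.
  have -> : lsum_coord (c *: x + y) a = c *: lsum_coord x a + lsum_coord y a by [].
  by rewrite linearP !mxE.
constructor; apply: (@Frame n U (dsum P) (fun p => mk_linear (lin p))) => /=.
- move=> p x /rowP h; apply: lsumP => a; apply: (frame_inj (f := F a)).
  by apply/rowP => j; have := h a; rewrite !mxE ord1.
- move=> p q h x; apply/rowP => a; rewrite !mxE.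
  by rewrite -(frame_natural (F a) h).
- by move=> p x a; rewrite mxE; apply: frame_supp.
- move=> p v hv.
  have ex a : exists y : P a p, F a p y = const_mx (v 0 a).
    by apply: frame_surj => j; rewrite mxE; apply: hv.
  pose y : dprod (fun a => P a p) := fun a => sval (cid (ex a)).
  have fy : fin_supp y by apply: finite_finset.
  exists (mk_lsum fy); apply/rowP => a; rewrite mxE.
  by rewrite /= (svalP (cid (ex a))) mxE.
Qed.

(** * Direct sums and the Krull-Schmidt theorem *)

Section Maps.
Variables (I : Type) (P : I -> pmod k R d).

Program Definition dsum_proj i : pmor (dsum P) (P i) :=
  @PMor k R d (dsum P) (P i)
    (fun p => mk_linear (f := fun x : dsum P p => lsum_coord x i) _) _.
Next Obligation. by []. Qed.
Next Obligation. by []. Qed.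

Definition single i p (x : P i p) : dprod (fun j => P j p) := fun j =>
  if pselect (i = j) is left e then eq_rect i (fun l => P l p) x j e else 0.

Lemma single_same i p (x : P i p) : single x i = x.
Proof.
by rewrite /single; case: pselect => // e; rewrite (Prop_irrelevance e erefl).
Qed.

Lemma single_other i j p (x : P i p) : i <> j -> single x j = 0.
Proof. by rewrite /single; case: pselect. Qed.

Lemma single_fin i p (x : P i p) : fin_supp (single x).
Proof.
apply: (@sub_finite_set _ _ [set i]%classic); last exact: finite_set1.
move=> j /= nz; apply: contrapT => ij; apply: nz; apply: single_other.
by move=> e; apply: ij.
Qed.

Program Definition dsum_incl i : pmor (P i) (dsum P) :=
  @PMor k R d (P i) (dsum P)
    (fun p => mk_linear (f := fun x => mk_lsum (single_fin x)) _) _.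
Next Obligation.
move=> i p a x y; apply: lsumP => j /=.
have [<-|ij] := pselect (i = j).
  by rewrite [LHS]single_same [RHS](congr2 (fun u v => a *: u + v) (single_same x) (single_same y)).
rewrite [LHS]single_other // [RHS](congr2 (fun u v => a *: u + v) (single_other x ij) (single_other y ij)).
by rewrite scaler0 addr0.
Qed.
Next Obligation.
move=> i p q h x; apply: lsumP => j /=.
have [<-|ij] := pselect (i = j).
  by rewrite [LHS]single_same [RHS](congr1 (pmap _ h) (single_same x)).
by rewrite [LHS]single_other // [RHS](congr1 (pmap _ h) (single_other x ij)) linear0.
Qed.

Lemma dsum_incl_same i p (x : P i p) : lsum_coord (dsum_incl i p x) i = x.
Proof. exact: single_same. Qed.

Lemma dsum_incl_other i j p (x : P i p) : i <> j ->
  lsum_coord (dsum_incl i p x) j = 0.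
Proof. exact: single_other. Qed.

Lemma dsum_proj_incl i p (x : P i p) : dsum_proj i p (dsum_incl i p x) = x.
Proof. exact: single_same. Qed.

Lemma dsum_proj_incl_other i j p (x : P i p) : i <> j ->
  dsum_proj j p (dsum_incl i p x) = 0.
Proof. exact: single_other. Qed.

Lemma dsum_decomp p (x : dsum P p) : exists s : seq {classic I},
  x = \sum_(i <- s) dsum_incl i p (lsum_coord x i).
Proof.
have /(@finite_seqP {classic I})[s hs] := lsum_coord_fin x.
exists (undup s); apply: lsumP => j.
rewrite -[RHS]/(dsum_proj j p _) linear_sum /=.
have [js|js] := boolP ((j : {classic I}) \in undup s).
  rewrite (bigD1_seq (j : {classic I})) ?undup_uniq //= dsum_incl_same big1 ?addr0 //.
  by move=> i /eqP ij; apply: dsum_incl_other.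
rewrite big_seq big1 => [|i is_].
  apply: contrapT => nz; case/negP: js; rewrite mem_undup.
  by have : [set` s]%classic (j : {classic I}) by rewrite -hs.
by apply: dsum_incl_other => ij; move: js; rewrite -ij is_.
Qed.

(** As x is a finite sum of its components, h cannot vanish on all of them.
    This finds the summand to be exchanged in the Krull-Schmidt theorem. *)
Lemma dsum_detect L (h : pmor (dsum P) L) p (x : dsum P p) :
  h p x <> 0 -> exists i, h p (dsum_incl i p (lsum_coord x i)) <> 0.
Proof.
move=> hx; apply: contrapT => /forallNP no; apply: hx.
have [s ->] := dsum_decomp x; rewrite linear_sum big1 // => i _.
by apply: contrapT => /no.
Qed.

End Maps.

(** The induction for the Krull-Schmidt theorem removes one summand from a
    family with an arbitrary index type. *)
Section Complement.
Variables (I : Type) (P : I -> pmod k R d) (i : I).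
Let J := {j | j <> i}.
Let PJ (j : J) := P (sval j).

Definition dsum_ext_fun p (y : dsum PJ p) : dprod (fun j => P j p) := fun j =>
  if pselect (j <> i) is left h then lsum_coord y (exist _ j h) else 0.

Lemma dsum_ext_fin p (y : dsum PJ p) : fin_supp (dsum_ext_fun y).
Proof.
apply: sub_finite_set (finite_image sval (lsum_coord_fin y)) => j /=.
by rewrite /dsum_ext_fun; case: pselect => // h nz; exists (exist _ j h).
Qed.

Program Definition dsum_ext : pmor (dsum PJ) (dsum P) :=
  @PMor k R d (dsum PJ) (dsum P)
    (fun p => mk_linear (f := fun y => mk_lsum (dsum_ext_fin y)) _) _.
Next Obligation.
move=> p a x y; apply: lsumP => j.
rewrite -[RHS]/(a *: dsum_ext_fun x j + dsum_ext_fun y j) /lsum_coord /= /dsum_ext_fun.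
by case: pselect => // _; rewrite scaler0 addr0.
Qed.
Next Obligation.
move=> p q h x; apply: lsumP => j.
rewrite -[RHS]/(pmap (P j) h (dsum_ext_fun x j)) /lsum_coord /= /dsum_ext_fun.
by case: pselect => // _; rewrite linear0.
Qed.

Lemma dsum_ext_coord p (y : dsum PJ p) (j : J) :
  lsum_coord (dsum_ext p y) (sval j) = lsum_coord y j.
Proof.
rewrite -[LHS]/(dsum_ext_fun y (sval j)) /dsum_ext_fun; case: j => j h /=.
by case: pselect => // h'; rewrite (Prop_irrelevance h' h).
Qed.

Lemma dsum_ext_self p (y : dsum PJ p) : lsum_coord (dsum_ext p y) i = 0.
Proof.
by rewrite -[LHS]/(dsum_ext_fun y i) /dsum_ext_fun; case: pselect => // h; case: (h erefl).
Qed.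

Lemma dsum_ext_surj p (x : dsum P p) : lsum_coord x i = 0 ->
  exists y, dsum_ext p y = x.
Proof.
move=> xi; pose y : dprod (fun j => PJ j p) := fun j => lsum_coord x (sval j).
have fy : fin_supp y.
  apply: (@finite_preimage _ _ [set j | lsum_coord x j <> 0]%classic (sval : J -> I)).
    by move=> [j hj] [l hl] _ _ /= e; apply: eq_exist.
  exact: lsum_coord_fin.
exists (mk_lsum fy); apply: lsumP => j.
have [->|ji] := pselect (j = i); first by rewrite dsum_ext_self.
by rewrite (dsum_ext_coord (mk_lsum fy) (exist _ j ji)).
Qed.

End Complement.

(** Dimension at most one, in a form inherited by subspaces and quotients
    without choosing bases. *)
Definition rank_le1 (S : lmodType k) := forall x y : S, x <> 0 -> exists c, y = c *: x.

Lemma frame1_rank_le1 W M p : frame1 W M -> rank_le1 (M p).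
Proof.
move=> F x y x0.
have nz : F p x 0 0 != 0.
  apply/eqP => e; apply: x0; apply: (frame_inj (f := F)).
  by apply/rowP => a; rewrite ord1 e mxE.
exists (F p y 0 0 / F p x 0 0); apply: (frame_eq (F := F)).
by apply/rowP => a; rewrite ord1 linearZ mxE divfK.
Qed.

Lemma rank_le1_sub (S : lmodType k) (T : linsub S) : rank_le1 S -> rank_le1 (linsub_type T).
Proof.
move=> S1 x y x0; have [|c yc] := S1 (val x) (val y).
  by move=> vx; apply: x0; apply: val_inj.
by exists c; apply: val_inj; rewrite yc.
Qed.

Lemma rank_le1_quot (S : lmodType k) (T : linsub S) : rank_le1 S -> rank_le1 (lquot T).
Proof.
move=> S1 x y x0; have [|c yc] := S1 (repr x) (repr y).
  move=> rx; apply: x0; rewrite -[x]lquot_piK rx.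
  by rewrite -(scale0r (0 : S)) lquot_piZ scale0r.
by exists c; rewrite -[x]lquot_piK -[y]lquot_piK yc lquot_piZ.
Qed.

Lemma frame1_point W M p : frame1 W M -> W p -> exists x : M p, x <> 0.
Proof.
move=> F Wp; have [x xE] := frame_basis F Wp (a := 0).
exists x => x0; move: xE; rewrite x0 linear0 => /rowP /(_ 0); rewrite !mxE !eqxx /=.
by move=> /esym/eqP; rewrite oner_eq0.
Qed.

Lemma frame1_nonzero W M : nonempty W -> frame1 W M -> ~ is_zero M.
Proof. by move=> [p Wp] F M0; have [x] := frame1_point F Wp; apply. Qed.

Lemma isom_inj M N p (f : pmor M N) (g : pmor N M) :
  cancel (f p) (g p) -> forall x, f p x = 0 -> x = 0.
Proof. by move=> fK x e; rewrite -[x]fK e linear0. Qed.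

(** Transition maps of a framed module are injective, and this passes to direct
    summands. *)
Lemma summand_map_inj n (U : 'I_n -> upset R d) I (P : I -> pmod k R d) i p q
    (h : (p <= q)%O) (x : P i p) :
  frame U (dsum P) -> pmap (P i) h x = 0 -> x = 0.
Proof.
move=> F hx; rewrite -(dsum_incl_same x).
rewrite (frame_map_inj F (h := h) (x := dsum_incl P i p x)) //.
by rewrite -pmor_natural hx linear0.
Qed.

(** Two nonzero summands would both be nonzero at a common upper bound of two
    points, where the module has dimension one. *)
Lemma frame1_indecomposable W M : nonempty W -> frame1 W M -> indecomposable M.
Proof.
move=> Wne F; split; first exact: frame1_nonzero Wne F.
move=> P MP; apply: contrapT => /not_orP[].
move=> /existsNP[p /existsNP[x x0]] /existsNP[q /existsNP[y y0]].
have [F'] := frame_isom F (isom_sym MP).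
have hp := le_maxl p q; have hq := le_maxr p q.
have [|c] := @frame1_rank_le1 W (dsum P) (pt_max p q) F'
  (dsum_incl P true _ (pmap _ hp x)) (dsum_incl P false _ (pmap _ hq y)).
  move=> e; apply: x0; apply: (summand_map_inj F' (h := hp)).
  by rewrite -(dsum_incl_same (pmap _ hp x)) e.
move=> e; apply: y0; apply: (summand_map_inj F' (h := hq)).
rewrite -(dsum_incl_same (pmap _ hq y)) e.
rewrite -[LHS]/(c *: lsum_coord (dsum_incl P true _ (pmap _ hp x)) false).
by rewrite dsum_incl_other // scaler0.
Qed.

Definition to_sub M (S : submod M) p (x : M p) (Sx : S p x) : linsub_type (S p) :=
  exist _ x (introT (linsub_predP _ _) Sx).

Lemma sub_mem M (S : submod M) p (z : sub_pmod S p) : S p (val z).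
Proof. exact/(linsub_predP (S p))/(valP z). Qed.

Section Kernel.
Variables (M N : pmod k R d) (f : pmor M N).

Program Definition ker_linsub p : linsub (M p) := @LinSub k (M p) (fun x => f p x = 0) _ _.
Next Obligation. by move=> p /=; rewrite linear0. Qed.
Next Obligation. by move=> p a u v /= fu fv; rewrite linearP fu fv scaler0 addr0. Qed.

Program Definition ker_submod : submod M := @SubMod k R d M ker_linsub _.
Next Obligation. by move=> p q h x fx; rewrite /= pmor_natural fx linear0. Qed.
End Kernel.

(** When v o u is bijective, P is the direct sum of L and the kernel of v, so
    the kernel of v vanishes. *)
Lemma split_mono_bij L P (u : pmor L P) (v : pmor P L) :
    indecomposable P -> ~ is_zero L ->
    (forall p x, v p (u p x) = 0 -> x = 0) ->
    (forall p y, exists x, v p (u p x) = y) ->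
  (forall p x, u p x = 0 -> x = 0) /\ (forall p y, exists x, u p x = y).
Proof.
move=> [_ indP] L0 inj surj; split=> [p x ux|].
  by apply: inj; rewrite ux linear0.
pose Q (b : bool) := if b then L else sub_pmod (ker_submod v).
pose kval p (z : sub_pmod (ker_submod v) p) : P p := val z.
have vker p z : v p (kval p z) = 0 := sub_mem z.
have lin p : linear (fun x : dsum Q p =>
    u p (lsum_coord x true) + kval p (lsum_coord x false)).
  move=> a x y; rewrite -[lsum_coord (a *: x + y) true]/(a *: lsum_coord x true + lsum_coord y true).
  rewrite -[kval p (lsum_coord (a *: x + y) false)]/(a *: kval p (lsum_coord x false) + kval p (lsum_coord y false)).
  by rewrite linearP scalerDr addrACA.
have nat p q (h : (p <= q)%O) (x : dsum Q p) :
    mk_linear (lin q) (pmap (dsum Q) h x) = pmap P h (mk_linear (lin p) x).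
  by rewrite /= linearD -pmor_natural.
have QP : isom (dsum Q) P.
  apply: (isom_of_bij (f := PMor nat)) => p /=.
    move=> x e; have xt : lsum_coord x true = 0.
      by apply: inj; move/(congr1 (v p)): e; rewrite linearD vker addr0 linear0.
    move: e; rewrite xt linear0 add0r => xf.
    by apply: lsumP => -[] //; apply: val_inj.
  move=> y; have [x xE] := surj p (v p y).
  have ky : ker_submod v p (y - u p x) by rewrite /= linearB xE subrr.
  pose z : sub_pmod (ker_submod v) p := to_sub ky.
  exists (dsum_incl Q true p x + dsum_incl Q false p z).
  have E b : lsum_coord (dsum_incl Q true p x + dsum_incl Q false p z) b =
    lsum_coord (dsum_incl Q true p x) b + lsum_coord (dsum_incl Q false p z) b by [].
  rewrite !E !dsum_incl_same !dsum_incl_other // addr0 add0r /kval /=.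
  by rewrite addrC subrK.
have [//|kz] := indP Q (isom_sym QP).
move=> p y; have [x xE] := surj p (v p y).
have ky : ker_submod v p (y - u p x) by rewrite /= linearB xE subrr.
exists x; pose z : sub_pmod (ker_submod v) p := to_sub ky.
by have /(congr1 val) /= := kz p z; move/eqP; rewrite subr_eq0 => /eqP->.
Qed.

(** End(k_W) = k is a field. *)
Lemma frame1_endo_bij W L (f : pmor L L) p x : frame1 W L -> f p x <> 0 ->
  (forall q y, f q y = 0 -> y = 0) /\ (forall q z, exists y, f q y = z).
Proof.
move=> F fx.
have Wne : nonempty W.
  exists p; apply: contrapT => Wp; apply: fx.
  rewrite (frame_inj (f := F) (x := x)) ?linear0 //.
  apply/rowP => a; rewrite mxE; apply/eqP/negPn/negP => /frame_supp; exact: Wp.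
have [A [fA _]] := matrix_of_morphism F F f (fun _ => Wne).
have A0 : A 0 0 != 0.
  apply/eqP => e; apply: fx; apply: (frame_inj (f := F)).
  by rewrite fA; apply/rowP => a; rewrite !mxE big_ord1 !ord1 e mulr0.
have AE (v : 'rV[k]_1) : v *m A = A 0 0 *: v.
  by apply/rowP => a; rewrite !mxE big_ord1 !ord1 mulrC.
split=> q y.
  move=> fy; apply: (frame_inj (f := F)); have := fA q y.
  by rewrite fy linear0 AE => /esym/eqP; rewrite scaler_eq0 (negPf A0) => /eqP.
exists ((A 0 0)^-1 *: y); apply: (frame_eq (F := F)).
by rewrite fA linearZ AE scalerA divff // scale1r.
Qed.

(** Induction on n.  Writing the identity of L = k_(U_0) as the sum of the
    maps L -> P_i -> L, one of them is nonzero, hence bijective, so that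
    L -> P_i is an isomorphism.  Then L and the sum of the other P_j are
    complementary, and the last n coordinates form a frame of the latter. *)
Lemma krull_schmidt n (U : 'I_n -> upset R d) I (P : I -> pmod k R d) :
    (forall a, nonempty (U a)) -> (forall i, indecomposable (P i)) ->
    frame U (dsum P) ->
  exists s : 'I_n -> I, [/\ injective s, forall i, exists a, s a = i &
    forall a, inhabited (frame1 (U a) (P (s a)))].
Proof.
elim: n U I P => [|n IH] U I P Une Pind F.
  have noI (i : I) : False.
    apply: (Pind i).1 => p x; rewrite -(dsum_incl_same x).
    rewrite (frame_inj (f := F) (x := dsum_incl P i p x)) //.
    by apply/rowP => -[].
  exists (fun a : 'I_0 => match a with Ordinal m h => False_rect I (notF h) end).
  by split=> [[]||[]] // i; case: (noI i).
have [FL] := upset_frame (U ord0); set L := upset_pmod k (U ord0) in FL.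
have [j b|u uE] := morphism_of_matrix FL F (A := delta_mx 0 ord0).
  by rewrite !ord1 mxE; have [->|] := eqVneq b ord0; rewrite //= eqxx.
have [a j|v vE] := morphism_of_matrix F FL (A := delta_mx ord0 0).
  by rewrite mxE; have [->|] := eqVneq a ord0; rewrite //= eqxx.
have vu p x : v p (u p x) = x.
  apply: (frame_eq (F := FL)); rewrite vE uE -mulmxA mul_delta_mx.
  by rewrite -[RHS]mulmx1; congr (_ *m _); apply/matrixP => a b; rewrite !mxE !ord1.
have [p0 U0] := Une ord0.
have [x0 x0n] := frame1_point FL U0.
have [|i hi] := dsum_detect (h := v) (x := u p0 x0); first by rewrite vu.
(* u_i : L -> P_i and v_i : P_i -> L have a nonzero composite. *)
pose ui := pmor_comp (dsum_proj P i) u; pose vi := pmor_comp v (dsum_incl P i).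
have L0 : ~ is_zero L by apply: frame1_nonzero (Une ord0) FL.
have [vui vus] := frame1_endo_bij (f := pmor_comp vi ui) FL hi.
have [uinj usurj] := split_mono_bij (Pind i) L0 vui vus.
have uE' p x b : F p (u p x) 0 b = FL p x 0 0 * (b == ord0)%:R.
  by rewrite uE mxE big_ord1 mxE.
pose PJ (j : {j | j <> i}) := P (sval j).
have lin p : linear (fun y => \row_a F p (dsum_ext P i p y) 0 (lift ord0 a)).
  by move=> c x y; apply/rowP => a; rewrite !mxE linearP linearP !mxE.
have [FJ] : inhabited (frame (fun a => U (lift ord0 a)) (dsum PJ)).
  constructor; apply: (@Frame n _ (dsum PJ) (fun p => mk_linear (lin p))).
  - move=> p y /rowP y0.
    have [|x xE] := frame_surj FL (p := p) (v := const_mx (F p (dsum_ext P i p y) 0 ord0)).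
      by move=> a; rewrite mxE; apply: frame_supp.
    have yu : dsum_ext P i p y = u p x.
      apply: (frame_eq (F := F)); apply/rowP => b; rewrite uE' xE mxE.
      case: (unliftP ord0 b) => [a|] ->; last by rewrite eqxx mulr1.
      by have := y0 a; rewrite !mxE => ->; rewrite mulr0.
    have x0' : x = 0.
      by apply: uinj; rewrite /= -yu dsum_ext_self.
    by apply: lsumP => j; rewrite -(dsum_ext_coord y) yu x0' linear0.
  - move=> p q h y.
    rewrite -[LHS]/(\row_a F q (dsum_ext P i q (pmap (dsum PJ) h y)) 0 (lift ord0 a)).
    by apply/rowP => a; rewrite !mxE pmor_natural frame_natural.
  - by move=> p y a; rewrite mxE; apply: (frame_supp (f := F)).
  - move=> p w hw.
    have [|x xE] := frame_surj F (p := p)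
        (v := \row_b if unlift ord0 b is Some a then w 0 a else 0).
      by move=> b; rewrite mxE; case: unliftP => [a ->|_]; rewrite ?eqxx // => /hw.
    (* Subtracting an element of L makes the i-th component vanish. *)
    have [z zE] := usurj p (lsum_coord x i).
    have [|y yE] := @dsum_ext_surj I P i p (x - u p z).
      rewrite -[LHS]/(lsum_coord x i - lsum_coord (u p z) i).
      by rewrite -zE subrr.
    exists y; apply/rowP => a; rewrite mxE yE linearB xE !mxE.
    by rewrite liftK uE' mulr0 subr0.
have [s [sinj ssurj sP]] := IH _ _ PJ (fun a => Une _) (fun j => Pind _) FJ.
exists (fun a => if unlift ord0 a is Some b then sval (s b) else i); split.
- move=> a b; case: unliftP => [a' ->|->]; case: unliftP => [b' ->|->] //.
  + by move=> /eq_sig_hprop e; congr lift; apply: sinj; apply: e => *; apply: Prop_irrelevance.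
  + by move=> e; case: (svalP (s a')).
  + by move=> e; case: (svalP (s b')).
- move=> j; have [->|ji] := pselect (j = i).
    by exists ord0; rewrite unlift_none.
  have [a sa] := ssurj (exist _ j ji).
  by exists (lift ord0 a); rewrite liftK sa.
- move=> a; case: unliftP => [a' ->|->]; first exact: sP.
  apply: (frame_isom FL); apply: isom_sym; exact: (isom_of_bij (f := ui) uinj usurj).
Qed.

(** * Prunings *)

Program Definition zero_linsub (V : lmodType k) : linsub V :=
  @LinSub k V (fun x => x = 0) _ _.
Next Obligation. by []. Qed.
Next Obligation. by move=> V a u v -> ->; rewrite scaler0 addr0. Qed.

Program Definition zero_submod M : submod M :=
  @SubMod k R d M (fun p => zero_linsub (M p)) _.
Next Obligation. by move=> M p q h x ->; rewrite /= linear0. Qed.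

Section CoordinateSubmodules.
Variables (n : nat) (U U' : 'I_n -> upset R d) (M : pmod k R d) (F : frame U M).

Program Definition coord_linsub p : linsub (M p) :=
  @LinSub k (M p) (fun x => forall a, F p x 0 a != 0 -> U' a p) _ _.
Next Obligation. by move=> p a; rewrite linear0 mxE eqxx. Qed.
Next Obligation.
move=> p c u v hu hv a; rewrite linearP !mxE => nz.
have [u0|] := eqVneq (F p u 0 a) 0; last exact: hu.
by apply: hv; move: nz; rewrite u0 mulr0 add0r.
Qed.

Program Definition coord_submod : submod M := @SubMod k R d M coord_linsub _.
Next Obligation.
move=> p q h x /= hx a; rewrite frame_natural => /hx Ua; exact: upsetP h.
Qed.

(** This serves both for a submodule k_W of k_X and for the pruning I/K, where
    K = 0. *)
Lemma frame_quot_sub (S Z : submod M) :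
    (forall a p, U' a p -> U a p) ->
    (forall p x, S p x <-> coord_submod p x) -> (forall p x, Z p x -> x = 0) ->
  inhabited (frame U' (quot_sub S Z)).
Proof.
move=> U'U SE Z0.
(* Since Z = 0, the chosen representative of a class is the only one. *)
pose lift p (z : quot_sub S Z p) : M p := val (repr z).
have liftE p (x : sub_pmod S p) : lift p (lquot_pi _ x) = val x.
  apply/eqP; rewrite -subr_eq0; apply/eqP/(Z0 p).
  exact: (lquot_reprB (restrict_submod S Z p) x).
have lin p : linear (fun z => F p (lift p z)).
  move=> c x y; rewrite -[x in LHS]lquot_piK -[y in LHS]lquot_piK -lquot_piZ -lquot_piD liftE.
  by rewrite -linearP.
constructor; apply: (@Frame n U' (quot_sub S Z) (fun p => mk_linear (lin p))).
- move=> p z /(frame_inj (f := F)) e.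
  have r0 : repr z = 0 by apply: val_inj.
  rewrite -[z]lquot_piK r0.
  by rewrite -(scale0r (0 : sub_pmod S p)) lquot_piZ scale0r.
- move=> p q h z.
  rewrite -[LHS]/(F q (lift q (lquot_pi (restrict_submod S Z q) (pmap (sub_pmod S) h (repr z))))).
  by rewrite -[RHS]/(F p (lift p z)) liftE -(frame_natural F h).
- by move=> p z a nz; apply: ((SE _ _).1 (sub_mem (repr z))).
- move=> p v hv; have [|x xE] := frame_surj F (p := p) (v := v).
    by move=> a /hv/U'U.
  have Sx : S p x by apply/SE => a; rewrite xE; apply: hv.
  exists (lquot_pi (restrict_submod S Z p) (to_sub Sx)).
  by rewrite -[LHS]/(F p (lift p (lquot_pi (restrict_submod S Z p) (to_sub Sx)))) liftE.
Qed.

End CoordinateSubmodules.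

Lemma subquotient_of_sub W X L M : frame1 W L -> frame1 X M ->
  (forall p, W p -> X p) -> subquotient L M.
Proof.
move=> FL FM WX.
exists (coord_submod (fun _ => W) FM), (zero_submod M); split.
  by move=> p x ->; apply: linsub0.
have [F] := frame_quot_sub (U' := fun=> W) (F := FM)
  (S := coord_submod (fun _ => W) FM) (Z := zero_submod M)
  (fun=> WX) (fun _ _ => iff_refl _) (fun _ _ => id).
exact: isom_of_frames FL F.
Qed.

Section PruningFrame.
Variables (e : R) (he : 0 <= e) (n : nat) (U : 'I_n -> upset R d).
Variables (M : pmod k R d) (F : frame U M).
Hypothesis Une : forall a, nonempty (U a).

Let F2 := frame_shift F (2 * e).

(** If x is in I_p, then the b for which some element of I_p has a nonzero
    b-th coordinate form a closed set, as I_p is stable under the elementary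
    matrices E_bc with U_b contained in U_c(2e).  Conversely, all matrices of
    morphisms M -> M(2e) map the coordinate subspace of a closed set into
    itself, so the cores satisfy the condition defining I. *)
Lemma pru_I_coord p (x : M p) : pru_I he M p x <-> coord_submod (core (2 * e) U) F p x.
Proof.
split=> [Ix a xa|].
  exists [set b | `[< exists2 y, pru_I he M p y & F p y 0 b != 0 >]]; split.
  - move=> b c; rewrite !finset.in_set => /asboolP[y Iy yb] Ubc; apply/asboolP.
    have [i j|f fE] := morphism_of_matrix F F2 (A := delta_mx b c).
      rewrite mxE; have [->|] := eqVneq i b; have [->|] := eqVneq j c; rewrite ?eqxx //=.
    have [z Iz zE] := pru_I_condP (imageP (f p) Iy).
    exists z => //; move/(congr1 (F2 p)): zE; rewrite fE => /rowP /(_ c).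
    rewrite !mxE (bigD1 b) //= big1 => [|j jb]; last by rewrite mxE (negPf jb) mulr0.
    rewrite mxE !eqxx mulr1 addr0 => zE.
    by rewrite -(frame_natural F (le_translate p (double_ge0 he))) zE.
  - by rewrite finset.in_set; apply/asboolP; exists x.
  - by move=> b; rewrite finset.in_set => /asboolP[y _]; apply: frame_supp.
apply: pru_I_largest => f q _ [y Sy <-].
have [A [fA hA]] := matrix_of_morphism F F2 f Une.
have Sz b : (F q y *m A) 0 b != 0 -> core (2 * e) U b q.
  rewrite mxE => nz.
  have [a ya|h] := pickP (fun a => F q y 0 a * A a b != 0); last first.
    by case/eqP: nz; apply: big1 => a _; apply/eqP; rewrite -[_ == _]negbK h.
  move: ya; rewrite mulf_eq0 => /norP[/Sy [C [clC aC hC]] /hA Uab].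
  by exists C; split=> //; apply: clC aC Uab.
have [|z zE] := frame_surj F (p := q) (v := F q y *m A).
  by move=> b /Sz /core_sub.
exists z; first by move=> b; rewrite zE; apply: Sz.
apply: (frame_eq (F := F2)); rewrite fA -zE.
exact: (frame_natural F (le_translate q (double_ge0 he))).
Qed.

(** Since M_(0->2e) is injective, the zero submodule satisfies the condition
    defining K. *)
Lemma pru_K_zero p (x : M p) : pru_K he M p x -> x = 0.
Proof.
move=> Kx; apply: (pru_K_smallest (K := zero_submod M) _ Kx); split.
  by move=> q y ->; apply: linsub0.
move=> f q y [_ [z ->]]; rewrite linear0 => /esym.
exact: (frame_map_inj F).
Qed.

Lemma frame_Pru : inhabited (frame (prune e U) (Pru he M)).
Proof.
have [G] := frame_quot_sub (fun a p => @core_sub R d n (2 * e) U a p)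
  pru_I_coord pru_K_zero.
exact: (inhabits (frame_shift G (- e))).
Qed.

End PruningFrame.

(** * Upset-decomposable modules and their barcodes *)

(** At a common point of m nonempty upsets, m linearly independent vectors
    appear. *)
Lemma nonempty_summands_le r M I (U : I -> upset R d) m (f : 'I_m -> I) :
    (forall p, dim_le (M p) r) -> isom M (dsum (fun i => upset_pmod k (U i))) ->
    injective f -> (forall j, nonempty (U (f j))) ->
  (m <= r)%N.
Proof.
move=> dimM [g [h gh]] fi fne.
have [p hp] := common_point fne.
have [n nr [[w wlin wbij]]] := dimM p.
pose P i := upset_pmod k (U i).
have ex j : exists v : P (f j) p, v <> 0.
  by have [F] := upset_frame (U (f j)); apply: frame1_point F (hp j).
pose v j := sval (cid (ex j)); have v0 j : v j <> 0 := svalP (cid (ex j)).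
pose wl := mk_linear wlin.
pose A := \matrix_j wl (h p (dsum_incl P (f j) p (v j))).
suff /eqP Am : row_free A by rewrite -Am; apply: leq_trans (rank_leq_col A) nr.
apply: inj_row_free => u uA.
have uE : u *m A = wl (h p (\sum_j u 0 j *: dsum_incl P (f j) p (v j))).
  rewrite mulmx_sum_row !linear_sum; apply: eq_bigr => j _.
  by rewrite rowK !linearZ.
have w_inj : injective wl := bij_inj wbij.
have [_ hK] := gh p.
have : \sum_j u 0 j *: dsum_incl P (f j) p (v j) = 0.
  by apply: (isom_inj hK); apply: w_inj; rewrite linear0 -uE.
move=> S0; apply/rowP => j; rewrite mxE; apply/eqP/negPn/negP => uj.
apply: (v0 j); move/(congr1 (dsum_proj P (f j) p)): S0.
rewrite linear_sum linear0 (bigD1 j) // big1 => [|i /andP[_ ij]].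
  rewrite [LHS]addr0 linearZZ dsum_proj_incl => /eqP.
  by rewrite scaler_eq0 (negPf uj) => /eqP.
by rewrite linearZZ dsum_proj_incl_other ?scaler0 // => /fi e; rewrite e eqxx in ij.
Qed.

(** The number of nonempty upsets is bounded by r, so a family of maximal length
    exhausts them; empty upsets contribute nothing to any coordinate. *)
Lemma frame_of_decomposable r M : upset_decomposable M ->
    (forall p, dim_le (M p) r) ->
  exists n (U : 'I_n -> upset R d),
    [/\ (n <= r)%N, forall a, nonempty (U a) & inhabited (frame U M)].
Proof.
move=> [I [U MU]] dimM.
pose good m := `[< exists f : 'I_m -> I, injective f /\ forall j, nonempty (U (f j)) >].
have ex0 : exists m, good m.
  exists 0%N; apply/asboolP.
  by exists (fun a : 'I_0 => match a with Ordinal m h => False_rect I (notF h) end); split=> -[].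
have bd m : good m -> (m <= r)%N.
  by move=> /asboolP[f [fi fne]]; apply: nonempty_summands_le dimM MU fi fne.
case: (ex_maxnP ex0 bd) => n /[dup] /bd nr /asboolP[f [fi fne]] nmax.
have fsurj i : nonempty (U i) -> exists a, f a = i.
  move=> Ui; apply: contrapT => /forallNP noi.
  have : good n.+1.
    apply/asboolP; exists (fun b => if unlift ord0 b is Some a then f a else i); split.
      move=> a b; case: unliftP => [a' ->|->]; case: unliftP => [b' ->|->] //.
      - by move=> /fi ->.
      - by move=> /noi.
      - by move=> /esym /noi.
    by move=> b; case: unliftP.
  by move/nmax; rewrite ltnn.
exists n, (fun a => U (f a)); split=> //.
have F i := upset_frame (U i).
have {}F i : frame1 (U i) (upset_pmod k (U i)) by apply: inhabited_witness.
set P := fun i => upset_pmod k (U i) in MU.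
have lin p : linear (fun x : dsum P p => \row_a (F (f a) p (lsum_coord x (f a))) 0 0).
  move=> c x y; apply/rowP => a; rewrite !mxE.
  have -> : lsum_coord (c *: x + y) (f a) = c *: lsum_coord x (f a) + lsum_coord y (f a) by [].
  by rewrite linearP !mxE.
suff [G] : inhabited (frame (fun a => U (f a)) (dsum P)).
  exact: (frame_isom G MU).
constructor; apply: (@Frame n _ (dsum P) (fun p => mk_linear (lin p))).
- move=> p x /rowP h; apply: lsumP => i; apply: (frame_inj (f := F i)).
  apply/rowP => j; rewrite ord1 mxE; apply/eqP/negPn/negP => nz.
  have [a ai] := fsurj i (ex_intro _ p (frame_supp nz)).
  by move: nz; rewrite -ai; have := h a; rewrite !mxE => ->; rewrite eqxx.
- move=> p q h x; apply/rowP => a; rewrite !mxE.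
  by rewrite -(frame_natural (F (f a)) h).
- by move=> p x a; rewrite mxE; apply: frame_supp.
- move=> p v hv.
  have ex i : exists y : P i p, (forall a, f a = i -> F i p y = const_mx (v 0 a)) /\
      ((forall a, f a <> i) -> y = 0).
    have [[a ai]|no] := pselect (exists a, f a = i); last first.
      by exists 0; split=> // a ai; case: no; exists a.
    have [j|y yE] := frame_surj (F i) (p := p) (v := const_mx (v 0 a)).
      by rewrite mxE -ai; apply: hv.
    by exists y; split=> [b bi|/(_ a)] //; rewrite (fi b a) // bi ai.
  pose y : dprod (fun i => P i p) := fun i => sval (cid (ex i)).
  have fy : fin_supp y.
    apply: (@sub_finite_set _ _ (range f)); last exact/finite_image/finite_finset.
    move=> i /= yi; apply: contrapT => no; apply: yi.
    by apply: (svalP (cid (ex i))).2 => a ai; apply: no; exists a.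
  exists (mk_lsum fy); apply/rowP => a; rewrite mxE.
  by rewrite [F _ _ _]((svalP (cid (ex (f a)))).1 a erefl) mxE.
Qed.

Lemma frame_barcode n (U : 'I_n -> upset R d) M : (forall a, nonempty (U a)) ->
  frame U M -> is_barcode M (fun a => upset_pmod k (U a)).
Proof.
move=> Une F; have G a : inhabited (frame1 (U a) (upset_pmod k (U a))) := upset_frame _.
split=> [a|]; first by have [Ga] := G a; apply: frame1_indecomposable (Une a) Ga.
have [|FD] := @dsum_frame n U (fun a => upset_pmod k (U a)).
  by move=> a; apply: inhabited_witness.
exact: isom_of_frames F FD.
Qed.

Lemma barcode_frame n (U : 'I_n -> upset R d) M I (P : I -> pmod k R d) :
    (forall a, nonempty (U a)) -> frame U M -> is_barcode M P ->
  exists s : 'I_n -> I, [/\ injective s, forall i, exists a, s a = i &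
    forall a, inhabited (frame1 (U a) (P (s a)))].
Proof.
move=> Une F [Pind MP]; have [G] := frame_isom F (isom_sym MP).
exact: krull_schmidt Une Pind G.
Qed.

Lemma interleaved_of_within e (he : 0 <= e) W X L M :
    frame1 W L -> frame1 X M -> within e W X -> within e X W ->
  interleaved he L M.
Proof.
move=> F G WX XW.
have [_ _ _|f fE] := morphism_of_matrix F (frame_shift G e) (A := 1%:M); first exact: WX.
have [_ _ _|g gE] := morphism_of_matrix G (frame_shift F e) (A := 1%:M); first exact: XW.
exists f, g; split=> p x.
  apply: (frame_eq (F := frame_shift (frame_shift F e) e)).
  rewrite [LHS](gE _ (f p x)) [RHS](frame_natural F) mulmx1.
  by rewrite [LHS](fE p x) mulmx1.
apply: (frame_eq (F := frame_shift (frame_shift G e) e)).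
rewrite [LHS](fE _ (g p x)) [RHS](frame_natural G) mulmx1.
by rewrite [LHS](gE p x) mulmx1.
Qed.

Lemma interleaved_sym e (he : 0 <= e) L M : interleaved he L M -> interleaved he M L.
Proof. by move=> [f [g [h1 h2]]]; exists g, f. Qed.

Lemma interleaved_nonzero e (he : 0 <= e) W L M (f : pmor L (shift M e))
    (g : pmor M (shift L e)) p :
    frame1 W L -> W p ->
    (forall p x, g (translate p e) (f p x) = pmap L (le_translate2 p he) x) ->
  exists x, f p x <> 0.
Proof.
move=> F Wp gf; have [x x0] := frame1_point F Wp; exists x => fx; apply: x0.
by apply: (frame_map_inj F (h := le_translate2 p he)); rewrite -gf fx linear0.
Qed.

Lemma within_of_interleaved e (he : 0 <= e) W X L M :
    frame1 W L -> frame1 X M -> interleaved he L M -> within e W X.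
Proof.
move=> F G [f [g [gf _]]] p Wp.
have [x fx] := interleaved_nonzero F Wp gf.
apply: contrapT => Xp; apply: fx; apply: (frame_inj (f := G)).
by apply/rowP => a; rewrite mxE; apply/eqP/negPn/negP => /frame_supp.
Qed.

(** All nonzero upset modules must be matched, because their transition maps are
    injective. *)
Lemma not_interleaved_zero e (he : 0 <= e) W L :
  nonempty W -> frame1 W L -> ~ interleaved he L (zero_pmod k R d).
Proof.
move=> [p Wp] F [f [g [gf _]]].
have [x] := interleaved_nonzero F Wp gf; apply.
by apply/rowP => -[].
Qed.

Lemma matching_of_within e (he : 0 <= e) n (U V : 'I_n -> upset R d) M N :
    (forall a, nonempty (U a)) -> (forall a, nonempty (V a)) ->
    frame U M -> frame V N ->
    (forall a, within e (U a) (V a)) -> (forall a, within e (V a) (U a)) ->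
  eps_matching he M N.
Proof.
move=> Une Vne F G UV VU.
exists 'I_n, 'I_n, (fun a => upset_pmod k (U a)), (fun a => upset_pmod k (V a)).
split; [exact: frame_barcode F|exact: frame_barcode G|].
exists setT, setT, id; split; [by exists id| |by move=> a []|by move=> a []].
move=> a; have [Fa] := upset_frame (U (sval a)); have [Ga] := upset_frame (V (sval a)).
exact: interleaved_of_within Fa Ga (UV _) (VU _).
Qed.

Lemma within_of_matching e (he : 0 <= e) n m (U : 'I_n -> upset R d)
    (V : 'I_m -> upset R d) M N :
    (forall a, nonempty (U a)) -> (forall a, nonempty (V a)) ->
    frame U M -> frame V N -> eps_matching he M N ->
  exists (s : 'I_n -> 'I_m) s', [/\ cancel s s', cancel s' s,
    forall a, within e (U a) (V (s a)) & forall a, within e (V (s a)) (U a)].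
Proof.
move=> Une Vne F G [I [J [P [Q [MP NQ [A [B [s [[s' sK s'K] PQ PA QB]]]]]]]]].
have [i [iinj isurj iP]] := barcode_frame Une F MP.
have [j [jinj jsurj jQ]] := barcode_frame Vne G NQ.
have inA a : A (i a).
  apply: contrapT => /PA; have [Fa] := iP a; exact: not_interleaved_zero Fa.
have inB b : B (j b).
  apply: contrapT => /QB; have [Gb] := jQ b; exact: not_interleaved_zero Gb.
pose iA a : A := exist _ (i a) (mem_set (inA a)).
pose jB b : B := exist _ (j b) (mem_set (inB b)).
pose t a := sval (cid (jsurj (sval (s (iA a))))).
have tE a : j (t a) = sval (s (iA a)) := svalP (cid (jsurj _)).
pose t' b := sval (cid (isurj (sval (s' (jB b))))).
have t'E b : i (t' b) = sval (s' (jB b)) := svalP (cid (isurj _)).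
have tB a : jB (t a) = s (iA a) by apply: val_inj; rewrite /= tE.
have t'A b : iA (t' b) = s' (jB b) by apply: val_inj; rewrite /= t'E.
exists t, t'; split=> a.
- by apply: iinj; rewrite t'E tB sK.
- by apply: jinj; rewrite tE t'A s'K.
- have [Fa] := iP a; have [Gb] := jQ (t a).
  apply: (within_of_interleaved (he := he) Fa Gb).
  by rewrite tE; exact: (PQ (iA a)).
- have [Fa] := iP a; have [Gb] := jQ (t a).
  apply: (within_of_interleaved (he := he) Gb Fa).
  by apply: interleaved_sym; rewrite tE; exact: (PQ (iA a)).
Qed.

Lemma refinement_of_within e c (he : 0 <= e) (hc : 0 <= c) n
    (U V : 'I_n -> upset R d) M N :
    (forall a, nonempty (U a)) -> (forall a, nonempty (V a)) ->
    frame U M -> frame V N ->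
    (forall a, within e (U a) (V a)) -> (forall a, within e (V a) (U a)) ->
  infty_refinement (Pru (addr_ge0 he hc) M) (Pru hc N).
Proof.
move=> Une Vne F G UV VU.
have [FP] := frame_Pru (addr_ge0 he hc) F Une; have [GP] := frame_Pru hc G Vne.
exists 'I_n, (fun a => upset_pmod k (prune c V a)), (fun a => upset_pmod k (prune (e + c) U a)).
split.
- by apply: frame_barcode GP => a; apply: prune_nonempty.
- move=> a; have [Fa] := upset_frame (prune (e + c) U a).
  have [Ga] := upset_frame (prune c V a).
  apply: subquotient_of_sub Fa Ga _ => p; exact: prune_within.
- by apply: (frame_barcode _ FP).2 => a; apply: prune_nonempty.
Qed.

(** Some maximal minor is nonzero, and hence some term in its Leibniz
    expansion. *)
Lemma row_free_injection n m (A : 'M[k]_(n, m)) : row_free A ->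
  exists2 s : 'I_n -> 'I_m, injective s & forall a, A a (s a) != 0.
Proof.
move=> Afree.
have Bfull : row_full A^T by rewrite /row_full mxrank_tr.
pose f := fullrankfun Bfull.
have : \det (rowsub f A^T) != 0.
  by rewrite -unitfE -unitmxE fullrowsub_unit.
move=> det0.
have [t ht] : exists t : 'S_n, \prod_i rowsub f A^T i (t i) != 0.
  apply: contrapT => /forallNP no; case/eqP: det0.
  rewrite /determinant big1 // => t _; have /negP := no t; rewrite negbK => /eqP ->.
  by rewrite mulr0.
exists (fun a => f (t^-1%g a)).
  by move=> a b /fullrankfun_inj /perm_inj.
move=> a; move/prodf_neq0: ht => /(_ (t^-1%g a) isT).
by rewrite !mxE permKV.
Qed.

Lemma subquotient_zero W M N p : frame1 W M -> subquotient N M ->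
  forall x : N p, x <> 0 -> W p.
Proof.
move=> F [S [Z [_ [f [g fg]]]]] x x0; apply: contrapT => Wp.
have M0 (y : M p) : y = 0.
  apply: (frame_inj (f := F)); apply/rowP => a; rewrite mxE.
  by apply/eqP/negPn/negP => /frame_supp.
apply: x0; have [fK _] := fg p; apply: (isom_inj fK).
rewrite -[LHS]lquot_piK.
have -> : repr (f p x) = 0 by apply: val_inj; rewrite /= (M0 (val _)).
by rewrite -(scale0r (0 : sub_pmod S p)) lquot_piZ scale0r.
Qed.

Lemma subquotient_rank_le1 M N p : rank_le1 (M p) -> subquotient N M -> rank_le1 (N p).
Proof.
move=> M1 [S [Z [_ [f [g fg]]]]] x y x0; have [fK _] := fg p.
have Q1 : rank_le1 (quot_sub S Z p) by apply/rank_le1_quot/rank_le1_sub.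
have [|c yc] := Q1 (f p x) (f p y); first by move=> /(isom_inj fK).
by exists c; rewrite -[y]fK yc linearZ fK.
Qed.

(** Let M be isomorphic to the sum of the Q_i, with Q_i a subquotient of P_i.  At
    a point p0 common to all U a, each Q_i has dimension at most one, so the
    images of the basis vectors e_a form a matrix; its rows are independent
    because the isomorphism is injective.  A nonzero entry at (a, b) forces the
    component of e_a in the b-th summand to be nonzero at every p in U a,
    since it agrees with the one at p0 further up and the maps of the Q_i are
    injective. *)
Lemma injection_of_refinement n m (U : 'I_n -> upset R d) (V : 'I_m -> upset R d) M N :
    (forall a, nonempty (U a)) -> (forall a, nonempty (V a)) ->
    frame U M -> frame V N -> infty_refinement M N ->
  exists2 s : 'I_n -> 'I_m, injective s & forall a p, U a p -> V (s a) p.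
Proof.
move=> Une Vne F G [I [P [Q [NP PQ MQ]]]].
have [s [sinj ssurj sP]] := barcode_frame Vne G NP.
have [FQ] := frame_isom F (isom_sym MQ).
have [p0 hp0] := common_point Une.
have ex p a : exists x, U a p -> FQ p x = delta_mx 0 a.
  have [Up|] := pselect (U a p); last by exists 0.
  by have [x xE] := frame_basis FQ Up; exists x.
pose e a := sval (cid (ex p0 a)).
have eE a : FQ p0 (e a) = delta_mx 0 a by apply: (svalP (cid (ex p0 a))).
(* A generator w of Q_(s b) at p0, which may be zero; the coefficient of 0 is
   required to be 0, so that a nonzero entry means a nonzero component. *)
have gen b : exists w : Q (s b) p0, forall y, exists c, y = c *: w /\ (y = 0 -> c = 0).
  have [[w w0]|no] := pselect (exists w : Q (s b) p0, w <> 0); last first.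
    exists 0 => y; exists 0; rewrite scaler0; split=> //; apply: contrapT => y0.
    by apply: no; exists y.
  exists w => y; have [Gb] := sP b.
  have [->|y0] := pselect (y = 0); first by exists 0; rewrite scale0r.
  have [c yc] := subquotient_rank_le1 (frame1_rank_le1 Gb) (PQ (s b)) y w0.
  by exists c.
pose w b := sval (cid (gen b)); have wP b := svalP (cid (gen b)).
pose c a b := sval (cid (wP b (lsum_coord (e a) (s b)))).
have cP a b : lsum_coord (e a) (s b) = c a b *: w b /\ (lsum_coord (e a) (s b) = 0 -> c a b = 0).
  exact: svalP (cid (wP b (lsum_coord (e a) (s b)))).
have Afree : row_free (\matrix_(a, b) c a b).
  apply: inj_row_free => v vA.
  have E : \sum_a v 0 a *: e a = 0.
    apply: lsumP => i; have [b <-] := ssurj i.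
    rewrite -[LHS]/(dsum_proj Q (s b) p0 _) linear_sum.
    transitivity (\sum_a (v 0 a * c a b) *: w b).
      by apply: eq_bigr => a _; rewrite linearZ /= (cP a b).1 scalerA.
    rewrite -scaler_suml; have := congr1 (fun u : 'rV_m => u 0 b) vA.
    by rewrite !mxE; under eq_bigr do rewrite mxE; move=> ->; rewrite scale0r.
  have := congr1 (FQ p0) E; rewrite linear_sum linear0 => <-.
  by rewrite [LHS]row_sum_delta; apply: eq_bigr => a _; rewrite linearZ eE.
have [t tinj tA] := row_free_injection Afree; exists t => // a p Up.
have [Gb] := sP (t a).
have [x xE] := ex p a; have {}xE := xE Up.
apply: (subquotient_zero Gb (PQ (s (t a))) (x := lsum_coord x (s (t a)))) => x0.
have hp := le_maxl p p0; have hq := le_maxr p p0.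
have xe : pmap (dsum Q) hp x = pmap (dsum Q) hq (e a).
  by apply: (frame_eq (F := FQ)); rewrite !frame_natural xE eE.
have : lsum_coord (e a) (s (t a)) = 0.
  apply: (summand_map_inj FQ (h := hq)).
  rewrite -[LHS]/(lsum_coord (pmap (dsum Q) hq (e a)) (s (t a))) -xe.
  by rewrite -[LHS]/(pmap _ hp (lsum_coord x (s (t a)))) x0 linear0.
by move=> /(cP a (t a)).2 c0; move: (tA a); rewrite mxE c0 eqxx.
Qed.

(** * Comparison of the two distances *)

Lemma refinements_of_matching e (he : 0 <= e) n m (U : 'I_n -> upset R d)
    (V : 'I_m -> upset R d) M N :
    (forall a, nonempty (U a)) -> (forall a, nonempty (V a)) ->
    frame U M -> frame V N -> eps_matching he M N ->
  forall c (hc : 0 <= c),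
    infty_refinement (Pru (addr_ge0 he hc) M) (Pru hc N) /\
    infty_refinement (Pru (addr_ge0 he hc) N) (Pru hc M).
Proof.
move=> Une Vne F G MN c hc.
have [s [s' [sK s'K UV VU]]] := within_of_matching Une Vne F G MN.
(* Numbering the summands of N along the matching makes it the identity. *)
have [G'] := frame_reindex G sK s'K.
by split; [apply: refinement_of_within F G' UV VU|apply: refinement_of_within G' F VU UV].
Qed.

(** The 0-pruning of a module lies inside the module itself, so the refinements
    give injections sigma and tau as in [backward_within]; they also show that
    n = m, and numbering V along sigma turns sigma into the matching. *)
Lemma matching_of_refinements e (he : 0 <= e) t (ht : 0 <= t) n m (U : 'I_n -> upset R d)
    (V : 'I_m -> upset R d) M N :
    (2 * n%:R - 1) * e <= t -> (forall a, nonempty (U a)) -> (forall a, nonempty (V a)) ->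
    frame U M -> frame V N ->
    infty_refinement (Pru (addr_ge0 he (lexx 0)) M) (Pru (lexx 0) N) ->
    infty_refinement (Pru (addr_ge0 he (lexx 0)) N) (Pru (lexx 0) M) ->
  eps_matching ht M N.
Proof.
move=> et Une Vne F G MN NM.
have [FM] := frame_Pru (addr_ge0 he (lexx 0)) F Une; have [FM0] := frame_Pru (lexx 0) F Une.
have [GN] := frame_Pru (addr_ge0 he (lexx 0)) G Vne; have [GN0] := frame_Pru (lexx 0) G Vne.
have pne c j (W : 'I_j -> upset R d) a := @prune_nonempty R d j c W a.
have [s sinj sP] := injection_of_refinement (fun a => pne _ _ _ a Une)
  (fun a => pne _ _ _ a Vne) FM GN0 MN.
have [t' tinj tP] := injection_of_refinement (fun a => pne _ _ _ a Vne)
  (fun a => pne _ _ _ a Une) GN FM0 NM.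
have nm : n = m.
  have := leq_card s sinj; have := leq_card t' tinj; rewrite !card_ord; lia.
subst m.
have US a p : prune e U a p -> V (s a) p.
  by move=> Up; apply: prune0_sub; apply: sP; rewrite addr0.
have VT a p : prune e V a p -> U (t' a) p.
  by move=> Vp; apply: prune0_sub; apply: tP; rewrite addr0.
have [s' sK s'K] := injF_bij sinj.
have [G'] := frame_reindex G sK s'K.
apply: matching_of_within Une _ F G' _ _ => // a.
- apply: (within_le et); exact: (forward_within he (US a)).
- apply: (within_le et); exact: (backward_within he sinj tinj US VT).
Qed.

End Modules.

Theorem theorem1p1 (k : fieldType) (R : realType) (d r : nat)
    (hd : (1 <= d)%N) (hr : (1 <= r)%N) (M N : pmod k R d)
    (hM : upset_decomposable M) (hN : upset_decomposable N)
    (dimM : forall p : Rd R d, dim_le (M p) r)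
    (dimN : forall p : Rd R d, dim_le (N p) r) :
  (dP M N <= dB M N)%E /\ (dB M N <= (2 * r%:R - 1)%R%:E * dP M N)%E.
Proof.
have [n [U [nr Une [F]]]] := frame_of_decomposable hM dimM.
have [m [V [_ Vne [G]]]] := frame_of_decomposable hN dimN.
split.
  apply: le_ereal_inf => _ [e [he MN] <-]; exists e => //; exists he.
  exact: (refinements_of_matching Une Vne F G MN).
have r1 : (1 <= r%:R :> R)%R by rewrite (ler_nat R 1).
have c0 : (0 < 2 * r%:R - 1 :> R)%R by lra.
rewrite -lee_pdivrMl //; apply/ereal_infP => _ [e [he Href] <-].
rewrite lee_pdivrMl // -EFinM.
have hE : (0 <= (2 * r%:R - 1) * e)%R by rewrite mulr_ge0 // ltW.
apply: ereal_inf_lbound; exists ((2 * r%:R - 1) * e)%R => //; exists hE.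
have [MN NM] := Href 0%R (lexx 0%R).
apply: (matching_of_refinements _ _ Une Vne F G MN NM).
by rewrite ler_wpM2r // lerB // ler_wpM2l // ler_nat.
Qed.
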